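(* Consider the planar nonsmooth Liénard system $$(\dot x,\dot y)=\begin{cases}(F^+(x)-y,\ g^+(x)) & \text{if } x>0,\\ (F^-(x)-y,\ g^-(x)) & \text{if } x<0,\end{cases}$$ where $f^\pm,g^\pm:\mathbb{R}\to\mathbb{R}$ are smooth and $F^\pm(x):=\int_0^x f^\pm(s)\,ds$. Assume: (1) there exists a constant $x_e\ge 0$ such that $g^+(x)(x-x_e)>0$ for all $x>0$ with $x\ne x_e$; (2) $f^+(x)>0$ for $x>0$ and $f^-(x)<0$ for $x<0$; (3) the limits $\lim_{p\to0^+}\frac{g^\pm(x^\pm(p))}{f^\pm(x^\pm(p))}=\eta^\pm$ exist and $-\infty<\eta^+\le\eta^-<+\infty$; moreover, if $\eta^+=\eta^-$, then $\frac{g^+(x^+(p))}{f^+(x^+(p))}<\frac{g^-(x^-(p))}{f^-(x^-(p))}$ for all sufficiently small $p>0$. Let $O=(0,0)$, and let $E=(x_e,F^+(x_e))$ if $x_e>0$ and $E=O$ if $x_e=0$. If the system has a crossing periodic orbit $\Gamma$, then: (i) $\Gamma$ surrounds $O$ and $E$ counterclockwise; (ii) the equations $$F^-(x^-)=F^+(x^+),\qquad \frac{g^-(x^-)}{f^-(x^-)}=\frac{g^+(x^+)}{f^+(x^+)}$$ have at least one solution $(x^-,x^+)=(x^-_*,x^+_* )$ with $x^-_*<0<x^+_*$ such that $\Gamma$ transversally intersects both lines $x=x^-_*$ and $x=x^+_*$.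
   Context: Solutions through points of the $y$-axis: since $F^\pm(0)=0$, $\dot x=-y$ on the $y$-axis. If $g^+(0)=g^-(0)$, then $\dot y=g^+(0)$ on the $y$-axis and the vector field is continuous; if $g^+(0)\neq g^-(0)$, solutions through points of the $y$-axis are defined by the Filippov convention. Thus orbits cross the positive $y$-axis from right to left and the negative $y$-axis from left to right. The origin is an equilibrium (a boundary equilibrium if $g^+(0)g^-(0)=0$, a pseudo-equilibrium if $g^+(0)g^-(0)<0$) when $g^+(0)g^-(0)\le 0$, and a regular point when $g^+(0)g^-(0)>0$. A crossing periodic orbit is a periodic orbit that intersects both $\{x>0\}$ and $\{x<0\}$. Definition of $x^\pm(p)$: let $p(x):=F^+(x)$ for $x\ge 0$ and $p(x):=F^-(x)$ for $x<0$, and let $p^\pm\in(0,+\infty]$ be the limits of $p(x)$ as $x\to\pm\infty$. Under assumption (2), $p$ is strictly increasing on $[0,\infty)$ and strictly decreasing on $(-\infty,0]$; $x^+:[0,p^+)\to[0,+\infty)$ and $x^-:[0,p^-)\to(-\infty,0]$ denote the corresponding strictly increasing, respectively strictly decreasing, inverse functions. *)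

(* Defs.v *)
From Stdlib Require Export Reals.
From Coquelicot Require Export Coquelicot.
Open Scope R_scope.

Definition smooth (f : R -> R) : Prop := forall (n : nat) (x : R), ex_derive_n f n x.

Definition int_from_0 (f : R -> R) (x : R) : R := RInt f 0 x.

(** ** The inverse functions [x^+] and [x^-]

    [Lim F p_infty] and [Lim F m_infty], elements of [Rbar], are the end points
    [p^+] and [p^-] of their domains.  Values of [xi] outside the domain are
    irrelevant. *)

Definition is_inverse_right (F xi : R -> R) : Prop :=
  (forall p, 0 <= p -> Rbar_lt p (Lim F p_infty) -> 0 <= xi p /\ F (xi p) = p) /\
  (forall x, 0 <= x -> xi (F x) = x).

Definition is_inverse_left (F xi : R -> R) : Prop :=
  (forall p, 0 <= p -> Rbar_lt p (Lim F m_infty) -> xi p <= 0 /\ F (xi p) = p) /\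
  (forall x, x <= 0 -> xi (F x) = x).

(** ** Lebesgue-null sets and absolutely continuous functions *)

Definition null_set (A : R -> Prop) : Prop :=
  forall eps, 0 < eps ->
  exists a b : nat -> R,
    (forall n, a n <= b n) /\
    (forall t, A t -> exists n, a n < t < b n) /\
    (forall N, sum_n (fun n => b n - a n) N <= eps).

Definition almost_everywhere (P : R -> Prop) : Prop := null_set (fun t => ~ P t).

(** [sum_n u n] has the [n+1] terms [u 0, ..., u n]. *)
Definition absolutely_continuous (h : R -> R) (a b : R) : Prop :=
  forall eps, 0 < eps ->
  exists delta, 0 < delta /\
    forall (n : nat) (s t : nat -> R),
      (forall i, (i <= n)%nat -> a <= s i /\ s i <= t i /\ t i <= b) ->
      (forall i j, (i < j <= n)%nat -> t i <= s j \/ t j <= s i) ->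
      sum_n (fun i => t i - s i) n < delta ->
      sum_n (fun i => Rabs (h (t i) - h (s i))) n < eps.

(** ** Filippov solutions of the Liénard system *)

(** [(u, v)] belongs to the set of admissible velocities at [(x, y)]: the vector
    field itself off the [y]-axis, the segment joining its two one-sided limits
    on the [y]-axis. *)
Definition filippov_field (Fp gp Fm gm : R -> R) (x y u v : R) : Prop :=
  (0 < x -> u = Fp x - y /\ v = gp x) /\
  (x < 0 -> u = Fm x - y /\ v = gm x) /\
  (x = 0 -> exists lam, 0 <= lam <= 1 /\
              u = lam * (Fp 0 - y) + (1 - lam) * (Fm 0 - y) /\
              v = lam * gp 0 + (1 - lam) * gm 0).

Definition filippov_solution (Fp gp Fm gm : R -> R) (x y : R -> R) : Prop :=
  (forall a b, a <= b -> absolutely_continuous x a b /\ absolutely_continuous y a b) /\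
  almost_everywhere (fun t =>
    exists u v, is_derive x t u /\ is_derive y t v /\
                filippov_field Fp gp Fm gm (x t) (y t) u v).

(** Equilibria in the Filippov sense.  When [Fp 0 = Fm 0 = 0], the origin is one
    exactly if [gp 0 * gm 0 <= 0] (boundary equilibria and pseudo-equilibria). *)
Definition equilibrium (Fp gp Fm gm : R -> R) (x y : R) : Prop :=
  filippov_field Fp gp Fm gm x y 0 0.

(** ** Periodic orbits, given by a parametrization [(x, y)] and its least period [T]

    As Filippov solutions may reach the pseudo-equilibrium [O] in finite time and
    leave it again, it has to be required that the orbit contains no
    equilibrium. *)
Definition periodic_orbit (Fp gp Fm gm : R -> R) (x y : R -> R) (T : R) : Prop :=
  filippov_solution Fp gp Fm gm x y /\
  0 < T /\
  (forall t, x (t + T) = x t /\ y (t + T) = y t) /\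
  (forall s, 0 < s < T -> ~ (forall t, x (t + s) = x t /\ y (t + s) = y t)) /\
  (forall t, ~ equilibrium Fp gp Fm gm (x t) (y t)).

Definition crossing_periodic_orbit (Fp gp Fm gm : R -> R) (x y : R -> R) (T : R) : Prop :=
  periodic_orbit Fp gp Fm gm x y T /\
  (exists t, 0 < x t) /\ (exists t, x t < 0).

(** The closed curve [(x, y)] of period [T] avoids [q] and has winding number [+1]
    around it: [theta] is a continuous polar angle of the curve seen from [q]. *)
Definition surrounds_counterclockwise (x y : R -> R) (T : R) (q : R * R) : Prop :=
  exists r theta : R -> R,
    (forall t, continuous theta t) /\
    (forall t, 0 < r t /\
               x t = fst q + r t * cos (theta t) /\
               y t = snd q + r t * sin (theta t)) /\
    theta T - theta 0 = 2 * PI.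

(** The orbit meets the line [{x = c}], and at every common point its velocity is
    not parallel to the line. *)
Definition transversally_intersects_vertical (x : R -> R) (c : R) : Prop :=
  (exists t, x t = c) /\
  (forall t, x t = c -> exists v, is_derive x t v /\ v <> 0).

Definition point_E (Fp : R -> R) (xe : R) : R * R :=
  if Rlt_dec 0 xe then (xe, Fp xe) else (0, 0).

(* Main.v *)
Require Import Defs.
From Stdlib Require Import ZArith Lra Lia Psatz Classical ClassicalEpsilon.
Open Scope R_scope.

(** The velocity [x' = p(x) - y] is continuous along the orbit, even at the
    [y]-axis, and the state [(x, x')] determines the solution: off the axis and on
    either side of it the field is smooth, and a point of the axis that is not an
    equilibrium is left into a definite side. A periodic function with injective
    state curve and simple critical points has a single maximum and a single minimum
    per period, since otherwise the state curve would spiral inwards for ever. So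
    every vertical line between the extrema is crossed transversally, once in each
    direction, which gives (i).

    For (ii), put the two half orbits in the plane of [p] and [x']. There
    [x' dx'/dp = x' - h], with [h = g/f], on each of the lower branch [x' = l] and the
    upper branch [x' = - u], so that [(l^2 - u^2)/2] has derivative [l + u], from which
    [h] has disappeared. If [h^+ < h^-] throughout, then [l + u] is larger on the right
    than on the left, although [(l^2 - u^2)/2] goes on both sides from the same value
    to [0]: a contradiction. As [h^+ < h^-] for small [p], [h^+] and [h^-] meet. *)

(** * Absolutely continuous functions *)

(** A Filippov solution is only absolutely continuous and obeys the inclusion almost everywhere.
    Both one-sided fields have first component [- y] on the axis, so [x] is [C^1] everywhere, while
    [y] may have a corner at each passage. The equation for [y] is therefore used only on open time
    intervals off the axis. The delicate point is a passage through a regular origin: [x'] vanishes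
    there but need not be differentiable, so a simple zero of [x'] has to mean a change of sign.
    Plane topology is replaced by intermediate value arguments on monotone arcs, where [x'] is a
    function of [x], and the winding number is read off an explicit polar angle. Uniqueness is
    proved forwards in time; periodicity carries it backwards. For (ii), [p] is the right coordinate
    because [p' = f x'] and [x'' = f x' - g]: the quotient of the two involves the data only through
    [h], and condition (2) makes [p] strictly monotone on each side. Condition (1) places [E]: [g^+]
    is positive at the rightmost point of the orbit, hence that point lies beyond [x_e]. *)

Lemma interval_induction (P : R -> Prop) (c d : R) :
  c <= d -> P c ->
  (forall z, c <= z <= d -> exists r, 0 < r /\
     forall e e', c <= e -> e' <= d -> z - r < e <= z -> z <= e' < z + r -> P e -> P e') ->
  P d.
Proof.
intros Hcd Pc Hstep.
(* The step hypothesis leads from a point just below the supremum to one just above it, so [P] need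
   not be closed under limits. *)
destruct (completeness (fun e => c <= e <= d /\ P e)) as [z [Hub Hlub]].
{ exists d. intros e [He _]. lra. }
{ exists c. split; [lra | exact Pc]. }
assert (Hcz : c <= z) by (apply Hub; split; [lra | exact Pc]).
assert (Hzd : z <= d) by (apply Hlub; intros e [He _]; lra).
destruct (Hstep z (conj Hcz Hzd)) as (r & Hr & Hz).
assert (exists e, c <= e <= z /\ z - r < e /\ P e) as (e & He & Her & Pe).
{ apply NNPP. intros Hno.
  assert (Hle : z <= z - r); [| lra].
  apply Hlub. intros e [He Pe].
  destruct (Rle_or_lt e (z - r)); [assumption | exfalso].
  apply Hno. exists e. repeat split; try lra; try assumption.
  apply Hub. split; assumption. }
destruct (Rle_or_lt d (z + r / 2)) as [Hd | Hd].
- apply (Hz e d); try lra. assumption.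
- assert (z + r / 2 <= z); [| lra].
  apply Hub. split; [lra |]. apply (Hz e); try lra. assumption.
Qed.

Definition clamp (a b t : R) : R := Rmin (Rmax t a) b.

Lemma clamp_mono a b s t : s <= t -> clamp a b s <= clamp a b t.
Proof.
intros. unfold clamp. apply Rle_min_compat_r. apply Rle_max_compat_r. assumption.
Qed.

Lemma clamp_bounds a b t : a <= b -> a <= clamp a b t <= b.
Proof.
intros. unfold clamp, Rmin, Rmax. repeat destruct Rle_dec; lra.
Qed.

Lemma clamp_id a b t : a <= t <= b -> clamp a b t = t.
Proof.
intros. unfold clamp, Rmin, Rmax. repeat destruct Rle_dec; lra.
Qed.

Lemma sum_n_le_compat (u v : nat -> R) n :
  (forall i, (i <= n)%nat -> u i <= v i) -> sum_n u n <= sum_n v n.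
Proof.
intros H. rewrite !sum_n_Reals. apply sum_Rle. exact H.
Qed.

Lemma sum_n_nonneg_mono (u : nat -> R) m n :
  (forall i, 0 <= u i) -> (m <= n)%nat -> sum_n u m <= sum_n u n.
Proof.
intros Hu Hmn. induction Hmn as [| n Hmn IH]; [lra |].
rewrite sum_Sn. unfold plus; simpl. specialize (Hu (S n)). lra.
Qed.

Lemma sum_n_nonneg_term (u : nat -> R) m n :
  (forall i, 0 <= u i) -> (m <= n)%nat -> u m <= sum_n u n.
Proof.
intros Hu Hmn. apply Rle_trans with (sum_n u m); [| apply sum_n_nonneg_mono; assumption].
destruct m as [| m]; [rewrite sum_O; lra |].
rewrite sum_Sn. unfold plus; simpl.
assert (0 <= sum_n u m); [| lra].
apply Rle_trans with (u 0%nat); [apply Hu |].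
replace (u 0%nat) with (sum_n u 0) by apply sum_O.
apply sum_n_nonneg_mono; [assumption | lia].
Qed.

(** * Covers of an exceptional null set *)

Section Cover.

Variables (a b : nat -> R).
Hypothesis ab : forall n, a n <= b n.

(** This is the length of [[s, t]] lying in the first [N + 1] intervals, counted with multiplicity.
    Being additive in [[s, t]], it bounds the total length of successive exceptional pieces even
    when the intervals overlap. *)
Let cov (s t : R) (N : nat) : R :=
  sum_n (fun n => clamp (a n) (b n) t - clamp (a n) (b n) s) N.

Lemma cover_term_nonneg s t n : s <= t -> 0 <= clamp (a n) (b n) t - clamp (a n) (b n) s.
Proof.
intros H. pose proof (clamp_mono (a n) (b n) s t H). lra.
Qed.

Lemma cover_chasles s t u N : cov s t N + cov t u N = cov s u N.
Proof.
unfold cov. change Rplus with (@plus R_AbelianMonoid). rewrite <- sum_n_plus.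
apply sum_n_ext. intros n. unfold plus; simpl. ring.
Qed.

Lemma cover_mono s t N M : s <= t -> (N <= M)%nat -> cov s t N <= cov s t M.
Proof.
intros. apply sum_n_nonneg_mono; [| assumption].
intros. apply cover_term_nonneg. assumption.
Qed.

Lemma cover_interval s t n N : a n < s -> s <= t -> t < b n -> (n <= N)%nat -> t - s <= cov s t N.
Proof.
intros Hs Hst Ht HN.
apply Rle_trans with (clamp (a n) (b n) t - clamp (a n) (b n) s).
- rewrite !clamp_id; lra.
- apply (sum_n_nonneg_term (fun n => clamp (a n) (b n) t - clamp (a n) (b n) s)); [| assumption].
  intros. apply cover_term_nonneg. assumption.
Qed.

Lemma cover_total s t N : cov s t N <= sum_n (fun n => b n - a n) N.
Proof.
apply sum_n_le_compat. intros n _.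
pose proof (clamp_bounds (a n) (b n) t (ab n)).
pose proof (clamp_bounds (a n) (b n) s (ab n)). lra.
Qed.

(* The slope of [h] is at most [k] except on finitely many intervals, each of which
   lies inside one [(a n, b n)]: there the absolute continuity of [h] will be used. *)
Definition controlled (h : R -> R) (k c e : R) : Prop :=
  exists (n : nat) (s t : nat -> R) (N : nat),
    (forall i, (i <= n)%nat -> c <= s i /\ s i <= t i /\ t i <= e) /\
    (forall i j, (i < j <= n)%nat -> t i <= s j) /\
    sum_n (fun i => t i - s i) n <= cov c e N /\
    h e - h c <= k * (e - c) + sum_n (fun i => Rabs (h (t i) - h (s i))) n
                 + Rabs k * sum_n (fun i => t i - s i) n.

Lemma controlled_good h k c e e' :
  c <= e <= e' -> h e' - h e <= k * (e' - e) -> controlled h k c e -> controlled h k c e'.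
Proof.
intros He Hh (n & s & t & N & H1 & H2 & H3 & H4).
exists n, s, t, N. split; [| split; [| split]].
- intros i Hi. destruct (H1 i Hi) as (? & ? & ?). repeat split; lra.
- exact H2.
- rewrite <- (cover_chasles c e e'). 
  assert (0 <= cov e e' N); [| lra].
  apply Rle_trans with (clamp (a 0%nat) (b 0%nat) e' - clamp (a 0%nat) (b 0%nat) e).
  + apply cover_term_nonneg; lra.
  + apply (sum_n_nonneg_term (fun n => clamp (a n) (b n) e' - clamp (a n) (b n) e) 0%nat); [| lia].
    intros. apply cover_term_nonneg; lra.
- lra.
Qed.

Lemma controlled_bad h k c e e' m :
  c <= e <= e' -> a m < e -> e' < b m -> controlled h k c e -> controlled h k c e'.
Proof.
intros He Ha Hb (n & s & t & N & H1 & H2 & H3 & H4).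
set (s' := fun i => if Nat.eq_dec i (S n) then e else s i).
set (t' := fun i => if Nat.eq_dec i (S n) then e' else t i).
assert (Hsum : forall F : R -> R -> R,
  sum_n (fun i => F (s' i) (t' i)) (S n) = sum_n (fun i => F (s i) (t i)) n + F e e').
{ intros F. rewrite sum_Sn. unfold plus; simpl. f_equal.
  - apply sum_n_ext_loc. intros i Hi. unfold s', t'. destruct Nat.eq_dec; [lia | reflexivity].
  - unfold s', t'. destruct Nat.eq_dec; [reflexivity | lia]. }
exists (S n), s', t', (Nat.max N m).
pose proof (Hsum (fun x y => y - x)) as Hs1. cbv beta in Hs1.
pose proof (Hsum (fun x y => Rabs (h y - h x))) as Hs2. cbv beta in Hs2.
rewrite Hs1, Hs2.
split; [| split; [| split]].
- intros i Hi. unfold s', t'. destruct Nat.eq_dec; [lra |].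
  destruct (H1 i) as (? & ? & ?); [lia |]. repeat split; lra.
- intros i j Hij. unfold s', t'. destruct (Nat.eq_dec i (S n)); [lia |].
  destruct (Nat.eq_dec j (S n)).
  + destruct (H1 i) as (? & ? & ?); [lia | lra].
  + apply H2. lia.
- rewrite <- (cover_chasles c e e').
  apply Rplus_le_compat.
  + apply Rle_trans with (cov c e N); [assumption |]. apply cover_mono; [lra | lia].
  + apply (cover_interval e e' m); try lra. lia.
(* No slope bound holds on this piece. The term [Rabs k] in [controlled] pays for a negative [k],
   since [k + Rabs k] is nonnegative. *)
- pose proof (Rle_abs (h e' - h e)).
  assert (- (Rabs k * (e' - e)) <= k * (e' - e)).
  { pose proof (Rle_abs (- k)). rewrite Rabs_Ropp in H0. nra. }
  rewrite Rmult_plus_distr_l. nra.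
Qed.

End Cover.

(** A Vitali-free substitute for integrating the derivative. Interval induction advances with slope
    at most [L + eps] near a good point and jumps inside a covering interval near a bad one;
    absolute continuity bounds the sum of all the jumps by [eps]. *)
Lemma ac_increment_le (h : R -> R) (c d L : R) :
  c <= d ->
  absolutely_continuous h c d ->
  almost_everywhere (fun t => c <= t <= d -> exists u, is_derive h t u /\ u <= L) ->
  h d - h c <= L * (d - c).
Proof.
intros Hcd Hac Hae.
assert (Main : forall eps, 0 < eps -> eps < 1 ->
  h d - h c <= L * (d - c) + eps * ((d - c) + 1 + (Rabs L + 1))).
{ intros eps Heps Heps1.
  destruct (Hac eps Heps) as (delta & Hdelta & Hd).
  (* Half of [delta], because the cover is bounded by a weak inequality and absolute continuity asks
     for a strict one; [eps], to make the term with [Rabs (L + eps)] small. *)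
  destruct (Hae (Rmin (delta / 2) eps)) as (a & b & Hab & Hcov & Htot).
  { apply Rmin_pos; lra. }
  assert (Hc : controlled a b h (L + eps) c d).
  { apply (interval_induction (fun e => controlled a b h (L + eps) c e) c d Hcd).
    - exists 0%nat, (fun _ => c), (fun _ => c), 0%nat. rewrite !sum_O.
      split; [| split; [| split]].
      + intros; lra.
      + intros; lia.
      + lra.
      + rewrite !Rminus_diag, Rabs_R0. lra.
    - intros z Hz.
      destruct (classic (c <= z <= d -> exists u, is_derive h z u /\ u <= L)) as [Hgood | Hbad].
      + destruct (Hgood Hz) as (u & Hu & HuL).
        destruct Hu as [_ Hu]. specialize (Hu z (fun P H => H)).
        destruct (Hu (mkposreal eps Heps)) as (r & Hr).
        assert (Hrr : forall q, Rabs (q - z) < r ->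
                  Rabs (h q - h z - (q - z) * u) <= eps * Rabs (q - z)).
        { intros q Hq. exact (Hr q Hq). }
        exists r. split; [apply cond_pos |].
        intros e e' He He' Hez Hze. apply controlled_good; [lra |].
        (* As [e <= z <= e'], the two errors of the linear approximation at [z] add up to exactly
           [eps * (e' - e)]. *)
        assert (A1 := Hrr e). assert (A2 := Hrr e').
        rewrite (Rabs_left1 (e - z)) in A1 by lra.
        rewrite (Rabs_pos_eq (e' - z)) in A2 by lra.
        specialize (A1 ltac:(lra)). specialize (A2 ltac:(lra)).
        apply Rabs_le_between in A1. apply Rabs_le_between in A2.
        assert ((e' - e) * u <= (e' - e) * L) by (apply Rmult_le_compat_l; lra).
        lra.
      + destruct (Hcov z Hbad) as (m & Hm).
        exists (Rmin (z - a m) (b m - z)). split; [apply Rmin_pos; lra |].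
        intros e e' He He' Hez Hze.
        pose proof (Rmin_l (z - a m) (b m - z)). pose proof (Rmin_r (z - a m) (b m - z)).
        apply (controlled_bad a b h (L + eps) c e e' m); lra. }
  destruct Hc as (n & s & t & N & H1 & H2 & H3 & H4).
  pose proof (cover_total a b Hab c d N) as H5.
  pose proof (Htot N) as H6.
  pose proof (Rmin_l (delta / 2) eps). pose proof (Rmin_r (delta / 2) eps).
  assert (H7 : sum_n (fun i => Rabs (h (t i) - h (s i))) n < eps).
  { apply Hd.
    - exact H1.
    - intros i j Hij. left. apply H2. exact Hij.
    - lra. }
  assert (H8 : Rabs (L + eps) <= Rabs L + 1).
  { pose proof (Rabs_triang L eps). rewrite (Rabs_pos_eq eps) in H8; lra. }
  assert (H9 : Rabs (L + eps) * sum_n (fun i => t i - s i) n <= (Rabs L + 1) * eps).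
  { apply Rle_trans with (Rabs (L + eps) * eps).
    - apply Rmult_le_compat_l; [apply Rabs_pos | lra].
    - apply Rmult_le_compat_r; lra. }
  lra. }
set (K := (d - c) + 1 + (Rabs L + 1)) in *.
assert (HK : 0 < K) by (unfold K; pose proof (Rabs_pos L); lra).
apply Rnot_lt_le. intros Hlt.
set (gap := h d - h c - L * (d - c)) in *.
assert (Hg : 0 < gap) by (unfold gap; lra).
set (eps := Rmin (1 / 2) (gap / (2 * K))).
assert (0 < gap / (2 * K)) by (apply Rdiv_lt_0_compat; lra).
assert (Heps : 0 < eps) by (apply Rmin_pos; lra).
pose proof (Rmin_l (1 / 2) (gap / (2 * K))). pose proof (Rmin_r (1 / 2) (gap / (2 * K))).
specialize (Main eps Heps ltac:(unfold eps; lra)).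
assert (eps * K <= gap / (2 * K) * K) by (apply Rmult_le_compat_r; unfold eps; lra).
replace (gap / (2 * K) * K) with (gap / 2) in * by (field; lra).
unfold gap in *. lra.
Qed.

Lemma null_set_incl (A B : R -> Prop) :
  (forall t, A t -> B t) -> null_set B -> null_set A.
Proof.
intros HAB HB eps Heps. destruct (HB eps Heps) as (a & b & H1 & H2 & H3).
exists a, b. repeat split; auto.
Qed.

Lemma almost_everywhere_impl (P Q : R -> Prop) :
  (forall t, P t -> Q t) -> almost_everywhere P -> almost_everywhere Q.
Proof.
intros H. apply null_set_incl. intros t HQ HP. auto.
Qed.

Lemma ac_opp (h : R -> R) c d :
  absolutely_continuous h c d -> absolutely_continuous (fun t => - h t) c d.
Proof.
intros H eps Heps. destruct (H eps Heps) as (delta & Hd & Hh). exists delta. split; [exact Hd |].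
intros n s t H1 H2 H3. specialize (Hh n s t H1 H2 H3).
erewrite sum_n_ext; [exact Hh |].
intros i. cbv beta. rewrite <- Rabs_Ropp. f_equal. ring.
Qed.

Lemma ac_increment_ge (h : R -> R) (c d L : R) :
  c <= d ->
  absolutely_continuous h c d ->
  almost_everywhere (fun t => c <= t <= d -> exists u, is_derive h t u /\ L <= u) ->
  L * (d - c) <= h d - h c.
Proof.
intros Hcd Hac Hae.
pose proof (ac_increment_le (fun t => - h t) c d (- L) Hcd (ac_opp h c d Hac)) as H.
assert (- h d - - h c <= - L * (d - c)); [| lra].
apply H. revert Hae. apply almost_everywhere_impl. intros t Ht Hct.
destruct (Ht Hct) as (u & Hu & HL). exists (- u). split; [| lra].
apply (is_derive_opp h t u Hu).
Qed.

Lemma ac_continuous (h : R -> R) (t : R) :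
  (forall c d, c <= d -> absolutely_continuous h c d) -> continuous h t.
Proof.
intros Hac. apply continuity_pt_filterlim. intros eps Heps.
destruct (Hac (t - 1) (t + 1) ltac:(lra) eps Heps) as (delta & Hd & H).
exists (Rmin delta 1). split; [apply Rmin_pos; lra |].
intros q [_ Hq]. simpl in *. unfold Rdist in *.
pose proof (Rmin_l delta 1). pose proof (Rmin_r delta 1).
assert (Hq' : Rabs (q - t) < delta /\ Rabs (q - t) < 1) by lra.
destruct Hq' as [Hq1 Hq2]. apply Rabs_def2 in Hq2.
specialize (H 0%nat (fun _ => Rmin q t) (fun _ => Rmax q t)).
rewrite !sum_O in H.
assert (Hmm : Rmax q t - Rmin q t = Rabs (q - t) /\
              Rabs (h (Rmax q t) - h (Rmin q t)) = Rabs (h q - h t)).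
{ unfold Rmax, Rmin. destruct Rle_dec.
  - rewrite (Rabs_left1 (q - t)) by lra. split; [ring | apply Rabs_minus_sym].
  - rewrite (Rabs_pos_eq (q - t)) by lra. split; reflexivity. }
destruct Hmm as [Hm1 Hm2]. rewrite <- Hm2. apply H.
- intros _ _. pose proof (Rmin_l q t). pose proof (Rmax_l q t).
  pose proof (Rmax_r q t). pose proof (Rmin_r q t).
  repeat split; unfold Rmin, Rmax in *; destruct Rle_dec; lra.
- intros; lia.
- rewrite Hm1. exact Hq1.
Qed.

(** Near [t] the derivative lies almost everywhere within [eps] of [phi t], so the increment bounds
    squeeze the difference quotient. This turns the inclusion into an ordinary equation wherever its
    right-hand side is single-valued and continuous along the orbit. *)
Lemma ac_derive (h phi : R -> R) (t : R) :
  (forall c d, c <= d -> absolutely_continuous h c d) ->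
  continuous phi t ->
  (exists r, 0 < r /\
     almost_everywhere (fun s => Rabs (s - t) < r -> is_derive h s (phi s))) ->
  is_derive h t (phi t).
Proof.
intros Hac Hphi (r & Hr & Hae).
apply is_derive_Reals. intros eps0 Heps0.
set (eps := eps0 / 2). assert (Heps : 0 < eps) by (unfold eps; lra).
apply continuity_pt_filterlim in Hphi.
destruct (Hphi eps Heps) as (del & Hdel & Hc).
assert (Hc' : forall s, Rabs (s - t) < del -> phi t - eps <= phi s <= phi t + eps).
{ intros s Hs. destruct (Req_dec t s) as [<- | Hne]; [lra |].
  specialize (Hc s). simpl in Hc. unfold Rdist, D_x, no_cond in Hc.
  specialize (Hc (conj (conj I Hne) Hs)). apply Rabs_def2 in Hc. lra. }
assert (Hrd : 0 < Rmin r del) by (apply Rmin_pos; lra).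
exists (mkposreal _ Hrd). intros k Hk0 Hk. simpl in Hk.
cut (Rabs (h (t + k) - h t - k * phi t) <= eps * Rabs k).
{ intros H. replace ((h (t + k) - h t) / k - phi t) with ((h (t + k) - h t - k * phi t) / k) by (field; assumption).
  unfold Rdiv. rewrite Rabs_mult, Rabs_inv.
  pose proof (Rabs_pos_lt k Hk0).
  apply Rle_lt_trans with (eps * Rabs k * / Rabs k).
  - apply Rmult_le_compat_r; [left; apply Rinv_0_lt_compat |]; assumption.
  - rewrite Rmult_assoc, Rinv_r by lra. unfold eps. lra. }
set (s := t + k) in *. replace k with (s - t) in * by (unfold s; ring).
clearbody s.
pose proof (Rmin_l r del). pose proof (Rmin_r r del).
assert (Hball : forall q, Rabs (q - t) <= Rabs (s - t) -> Rabs (q - t) < r /\ Rabs (q - t) < del)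
  by (intros; lra).
assert (Hgen : forall c d, c <= d -> (forall q, c <= q <= d -> Rabs (q - t) <= Rabs (s - t)) ->
   (phi t - eps) * (d - c) <= h d - h c <= (phi t + eps) * (d - c)).
{ intros c d Hcd Hin. split.
  - apply ac_increment_ge; [assumption | apply Hac; assumption |].
    revert Hae. apply almost_everywhere_impl. intros q Hq Hqc.
    destruct (Hball q (Hin q Hqc)). exists (phi q). split; [auto | apply Hc'; assumption].
  - apply ac_increment_le; [assumption | apply Hac; assumption |].
    revert Hae. apply almost_everywhere_impl. intros q Hq Hqc.
    destruct (Hball q (Hin q Hqc)). exists (phi q). split; [auto | apply Hc'; assumption]. }
destruct (Rle_or_lt t s) as [Hts | Hts].
- destruct (Hgen t s Hts) as [G1 G2].
  { intros q Hq. rewrite !Rabs_pos_eq; lra. }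
  rewrite (Rabs_pos_eq (s - t)) by lra. apply Rabs_le_between. lra.
- destruct (Hgen s t ltac:(lra)) as [G1 G2].
  { intros q Hq. rewrite !Rabs_left1; lra. }
  rewrite (Rabs_left1 (s - t)) by lra. apply Rabs_le_between. lra.
Qed.

(** * Real functions of one variable *)

Lemma continuous_eps (f : R -> R) (t : R) :
  continuous f t <->
  (forall eps, 0 < eps -> exists r, 0 < r /\ forall s, Rabs (s - t) < r -> Rabs (f s - f t) < eps).
Proof.
split.
- intros H eps Heps. apply continuity_pt_filterlim in H.
  destruct (H eps Heps) as (r & Hr & Hs). exists r. split; [exact Hr |].
  intros s Hst. destruct (Req_dec t s) as [<- | Hne].
  + rewrite Rminus_diag, Rabs_R0. exact Heps.
  + apply (Hs s). split; [split; [exact I | exact Hne] | exact Hst].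
- intros H. apply continuity_pt_filterlim. intros eps Heps.
  destruct (H eps Heps) as (r & Hr & Hs). exists r. split; [exact Hr |].
  intros s [_ Hst]. apply Hs. exact Hst.
Qed.

Lemma continuous_gt (f : R -> R) (t l : R) :
  continuous f t -> l < f t -> exists r, 0 < r /\ forall s, Rabs (s - t) < r -> l < f s.
Proof.
intros Hc Hl. destruct (proj1 (continuous_eps f t) Hc (f t - l) ltac:(lra)) as (r & Hr & H).
exists r. split; [exact Hr |]. intros s Hs. specialize (H s Hs). apply Rabs_def2 in H. lra.
Qed.

Lemma continuous_lt (f : R -> R) (t l : R) :
  continuous f t -> f t < l -> exists r, 0 < r /\ forall s, Rabs (s - t) < r -> f s < l.
Proof.
intros Hc Hl. destruct (proj1 (continuous_eps f t) Hc (l - f t) ltac:(lra)) as (r & Hr & H).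
exists r. split; [exact Hr |]. intros s Hs. specialize (H s Hs). apply Rabs_def2 in H. lra.
Qed.

Lemma is_derive_continuous (f : R -> R) t l : is_derive f t l -> continuous f t.
Proof.
intros H. apply @ex_derive_continuous. exists l. exact H.
Qed.

Lemma mean_value (f df : R -> R) (a b : R) :
  a < b -> (forall t, a <= t <= b -> continuous f t) ->
  (forall t, a < t < b -> is_derive f t (df t)) ->
  exists c, a < c < b /\ f b - f a = df c * (b - a).
Proof.
intros Hab Hc Hd.
assert (pr1 : forall c, a < c < b -> derivable_pt f c).
{ intros c Hcab. exists (df c). apply is_derive_Reals, Hd. exact Hcab. }
assert (pr2 : forall c, a < c < b -> derivable_pt id c) by (intros; apply derivable_pt_id).
destruct (MVT f id a b pr1 pr2 Hab) as (c & Hcab & H).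
- intros c Hcc. apply continuity_pt_filterlim, Hc. exact Hcc.
- intros c _. apply derivable_continuous_pt, derivable_pt_id.
- exists c. split; [exact Hcab |].
  rewrite (derive_pt_eq_0 f c (df c) (pr1 c Hcab)) in H by (apply is_derive_Reals, Hd, Hcab).
  rewrite (derive_pt_eq_0 id c 1 (pr2 c Hcab)) in H by apply derivable_pt_lim_id.
  unfold id in H. lra.
Qed.

Lemma increasing_of_derive (f df : R -> R) (a b : R) :
  (forall t, a <= t <= b -> continuous f t) ->
  (forall t, a < t < b -> is_derive f t (df t) /\ 0 < df t) ->
  forall s t, a <= s -> s < t -> t <= b -> f s < f t.
Proof.
intros Hc Hd s t Hs Hst Ht.
destruct (mean_value f df s t Hst) as (c & Hcst & Hm).
- intros; apply Hc; lra.
- intros; apply Hd; lra.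
- destruct (Hd c ltac:(lra)) as [_ Hpos]. nra.
Qed.

Lemma decreasing_of_derive (f df : R -> R) (a b : R) :
  (forall t, a <= t <= b -> continuous f t) ->
  (forall t, a < t < b -> is_derive f t (df t) /\ df t < 0) ->
  forall s t, a <= s -> s < t -> t <= b -> f t < f s.
Proof.
intros Hc Hd s t Hs Hst Ht.
destruct (mean_value f df s t Hst) as (c & Hcst & Hm).
- intros; apply Hc; lra.
- intros; apply Hd; lra.
- destruct (Hd c ltac:(lra)) as [_ Hpos]. nra.
Qed.

Lemma intermediate_value (f : R -> R) (a b l : R) :
  a <= b -> (forall t, continuous f t) -> Rmin (f a) (f b) <= l <= Rmax (f a) (f b) ->
  exists c, a <= c <= b /\ f c = l.
Proof.
intros Hab Hc Hl.
destruct (IVT_gen f a b l) as (c & Hcab & Hcl).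
- intros t. apply continuity_pt_filterlim, Hc.
- exact Hl.
- exists c. rewrite Rmin_left, Rmax_right in Hcab by lra. split; assumption.
Qed.

(** The inverse is continued by constants outside [[phi a, phi b]], which makes it continuous on the
    whole line. Derivatives are confined to the open interval because the end points will be turning
    points or points of the axis. *)
Lemma increasing_inverse (phi dphi : R -> R) (a b : R) :
  a <= b -> (forall t, continuous phi t) ->
  (forall t, a < t < b -> is_derive phi t (dphi t) /\ 0 < dphi t) ->
  exists psi : R -> R,
    (forall p, a <= psi p <= b) /\
    (forall p, continuous psi p) /\
    (forall t, a <= t <= b -> psi (phi t) = t) /\
    (forall p, phi a <= p <= phi b -> phi (psi p) = p) /\
    (forall t, a < t < b -> is_derive psi (phi t) (/ dphi t)).
Proof.
intros Hab Hc Hd.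
assert (Hinc : forall s t, a <= s -> s < t -> t <= b -> phi s < phi t)
  by (apply (increasing_of_derive phi dphi); auto).
assert (Hinc' : forall s t, a <= s <= b -> a <= t <= b -> phi s < phi t -> s < t).
{ intros s t Hs Ht Hst. destruct (Rtotal_order s t) as [H | [H | H]]; [exact H | subst; lra |].
  specialize (Hinc t s). lra. }
assert (Hends : phi a <= phi b).
{ destruct (Req_dec a b) as [-> | ]; [lra |]. left. apply Hinc; lra. }
assert (Hex : forall p, exists t, a <= t <= b /\ phi t = clamp (phi a) (phi b) p).
{ intros p. apply intermediate_value; [exact Hab | exact Hc |].
  rewrite Rmin_left, Rmax_right by lra. apply clamp_bounds. exact Hends. }
set (psi := fun p => proj1_sig (constructive_indefinite_description _ (Hex p))).
assert (Hpsi : forall p, a <= psi p <= b /\ phi (psi p) = clamp (phi a) (phi b) p).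
{ intros p. unfold psi. destruct constructive_indefinite_description as [t Ht]. exact Ht. }
assert (Hcl : forall p q, Rabs (clamp (phi a) (phi b) q - clamp (phi a) (phi b) p) <= Rabs (q - p)).
{ intros p q. unfold clamp, Rmin, Rmax, Rabs. repeat destruct Rle_dec; repeat destruct Rcase_abs; lra. }
assert (Hinv : forall t, a <= t <= b -> psi (phi t) = t).
{ intros t Ht. destruct (Hpsi (phi t)) as [H1 H2].
  rewrite clamp_id in H2.
  - destruct (Rtotal_order (psi (phi t)) t) as [H | [H | H]]; [| exact H |].
    + specialize (Hinc _ t (proj1 H1) H (proj2 Ht)). lra.
    + specialize (Hinc t _ (proj1 Ht) H (proj2 H1)). lra.
  - split.
    + destruct (Req_dec a t) as [-> | ]; [lra |]. left. apply Hinc; lra.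
    + destruct (Req_dec t b) as [-> | ]; [lra |]. left. apply Hinc; lra. }
assert (Hcont : forall p, continuous psi p).
{ intros p. apply continuous_eps. intros eps Heps.
  destruct (Hpsi p) as [Hp1 Hp2].
  assert (Hup : exists r, 0 < r /\ forall q, Rabs (q - p) < r -> psi q < psi p + eps).
  { destruct (Rle_or_lt b (psi p + eps / 2)) as [Hb | Hb].
    - exists 1. split; [lra |]. intros q _. destruct (Hpsi q). lra.
    - exists (phi (psi p + eps / 2) - phi (psi p)). split.
      + assert (phi (psi p) < phi (psi p + eps / 2)) by (apply Hinc; lra). lra.
      + intros q Hq. destruct (Hpsi q) as [Hq1 Hq2].
        assert (psi q < psi p + eps / 2); [| lra].
        apply Hinc'; try lra. specialize (Hcl p q). rewrite <- Hp2, <- Hq2 in Hcl.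
        pose proof (Rle_abs (phi (psi q) - phi (psi p))). lra. }
  assert (Hlo : exists r, 0 < r /\ forall q, Rabs (q - p) < r -> psi p - eps < psi q).
  { destruct (Rle_or_lt (psi p - eps / 2) a) as [Hb | Hb].
    - exists 1. split; [lra |]. intros q _. destruct (Hpsi q). lra.
    - exists (phi (psi p) - phi (psi p - eps / 2)). split.
      + assert (phi (psi p - eps / 2) < phi (psi p)) by (apply Hinc; lra). lra.
      + intros q Hq. destruct (Hpsi q) as [Hq1 Hq2].
        assert (psi p - eps / 2 < psi q); [| lra].
        apply Hinc'; try lra. specialize (Hcl p q). rewrite <- Hp2, <- Hq2 in Hcl.
        pose proof (Rle_abs (- (phi (psi q) - phi (psi p)))). rewrite Rabs_Ropp in H. lra. }
  destruct Hup as (r1 & Hr1 & H1). destruct Hlo as (r2 & Hr2 & H2).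
  exists (Rmin r1 r2). split; [apply Rmin_pos; assumption |]. intros q Hq.
  pose proof (Rmin_l r1 r2). pose proof (Rmin_r r1 r2).
  specialize (H1 q ltac:(lra)). specialize (H2 q ltac:(lra)). apply Rabs_def1; lra. }
exists psi. split; [intros p; apply Hpsi |]. split; [exact Hcont |]. split; [exact Hinv |].
split.
{ intros p Hp. destruct (Hpsi p) as [_ H]. rewrite H. apply clamp_id. exact Hp. }
intros t Ht. destruct (Hd t Ht) as [Hdt Hpos]. set (d := dphi t) in *.
apply is_derive_Reals. intros eps Heps.
apply is_derive_Reals in Hdt.
(* The first bound keeps the difference quotient [q] of [phi] above [d / 2]. The second then gives
   [Rabs (d - q) / (q * d) < eps], which is the error of the reciprocal. *)
set (eta := Rmin (d / 2) (eps * (d * d) / 4)).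
assert (0 < d * d) by nra.
assert (Heta : 0 < eta) by (apply Rmin_pos; nra).
assert (He1 : eta <= d / 2) by apply Rmin_l.
assert (He2 : eta <= eps * (d * d) / 4) by apply Rmin_r.
destruct (Hdt eta Heta) as (r & Hr).
assert (Hpt : psi (phi t) = t) by (apply Hinv; lra).
destruct (proj1 (continuous_eps psi (phi t)) (Hcont (phi t)) r (cond_pos r)) as (r1 & Hr1 & Hp).
assert (Hlo : phi a < phi t) by (apply Hinc; lra).
assert (Hhi : phi t < phi b) by (apply Hinc; lra).
assert (Hm : 0 < Rmin r1 (Rmin (phi t - phi a) (phi b - phi t)))
  by (repeat apply Rmin_pos; lra).
exists (mkposreal _ Hm). intros k Hk0 Hk. simpl in Hk.
pose proof (Rmin_l r1 (Rmin (phi t - phi a) (phi b - phi t))).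
pose proof (Rmin_r r1 (Rmin (phi t - phi a) (phi b - phi t))).
pose proof (Rmin_l (phi t - phi a) (phi b - phi t)).
pose proof (Rmin_r (phi t - phi a) (phi b - phi t)).
assert (Hkab : Rabs k < phi t - phi a /\ Rabs k < phi b - phi t) by lra.
destruct Hkab as [Hka Hkb]. apply Rabs_def2 in Hka. apply Rabs_def2 in Hkb.
specialize (Hp (phi t + k)). replace (phi t + k - phi t) with k in Hp by ring.
specialize (Hp ltac:(lra)). rewrite Hpt in Hp |- *.
destruct (Hpsi (phi t + k)) as [_ Hk2]. rewrite clamp_id in Hk2 by lra.
set (h := psi (phi t + k) - t) in *.
replace (psi (phi t + k)) with (t + h) in Hk2 by (unfold h; ring).
assert (Hh0 : h <> 0). { intros Hh. rewrite Hh, Rplus_0_r in Hk2. lra. }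
specialize (Hr h Hh0 Hp). rewrite Hk2 in Hr.
replace (phi t + k - phi t) with k in Hr by ring.
apply Rabs_def2 in Hr.
set (q := k / h) in *. assert (Hkq : k = q * h) by (unfold q; field; exact Hh0).
assert (Hq : d / 2 < q) by lra.
replace (h / k) with (/ q) by (unfold q; field; split; assumption).
replace (/ q - / d) with ((d - q) * / (q * d)) by (field; lra).
rewrite Rabs_mult, (Rabs_pos_eq (/ (q * d))) by (left; apply Rinv_0_lt_compat; nra).
assert (Hdq : Rabs (d - q) < eta) by (apply Rabs_def1; lra).
apply Rmult_lt_reg_r with (q * d); [nra |].
rewrite Rmult_assoc, Rinv_l by nra.
apply Rlt_le_trans with eta; [lra |].
apply Rle_trans with (eps * (d * d) / 4); [exact He2 |].
assert (eps * (d * d) <= eps * (2 * (q * d))) by (apply Rmult_le_compat_l; nra). 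
assert (0 < eps * (q * d)) by (apply Rmult_lt_0_compat; nra). lra.
Qed.

(** Positivity is required only just after [a], since [a] will itself be a zero of [v]. *)
Lemma first_zero (v : R -> R) (a b : R) :
  (forall t, continuous v t) -> a < b -> v b = 0 ->
  (exists r, 0 < r /\ forall t, a < t < a + r -> 0 < v t) ->
  exists c, a < c <= b /\ v c = 0 /\ forall t, a < t < c -> 0 < v t.
Proof.
intros Hv Hab Hb (r & Hr & Hra).
destruct (completeness (fun c => a <= c <= b /\ forall t, a < t < c -> 0 < v t)) as [c [Hub Hlub]].
{ exists b. intros c [Hc _]. lra. }
{ exists a. split; [lra |]. intros; lra. }
assert (Hcb : c <= b) by (apply Hlub; intros e [He _]; lra).
assert (Hac : a < c).
{ apply Rlt_le_trans with (Rmin (a + r) b).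
  - apply Rmin_glb_lt; lra.
  - apply Hub. split.
    + split; [| apply Rmin_r]. left. apply Rmin_glb_lt; lra.
    + intros t Ht. apply Hra. pose proof (Rmin_l (a + r) b). lra. }
assert (Hpos : forall t, a < t < c -> 0 < v t).
{ intros t Ht. apply NNPP. intros Hn. assert (c <= t); [| lra].
  apply Hlub. intros e [He1 He2]. apply Rnot_lt_le. intros Het. apply Hn, He2. lra. }
exists c. split; [lra |]. split; [| exact Hpos].
destruct (Rtotal_order (v c) 0) as [H | [H | H]]; [exfalso | exact H | exfalso].
- destruct (continuous_lt v c 0 (Hv c) H) as (e & He & Hs).
  specialize (Hs (Rmax ((a + c) / 2) (c - e / 2))).
  pose proof (Rmax_l ((a + c) / 2) (c - e / 2)). pose proof (Rmax_r ((a + c) / 2) (c - e / 2)).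
  assert (Hlt : Rmax ((a + c) / 2) (c - e / 2) < c) by (apply Rmax_lub_lt; lra).
  specialize (Hpos (Rmax ((a + c) / 2) (c - e / 2)) ltac:(lra)).
  rewrite Rabs_left in Hs by lra. specialize (Hs ltac:(lra)). lra.
- destruct (Req_dec c b) as [-> | Hne]; [lra |].
  destruct (continuous_gt v c 0 (Hv c) H) as (e & He & Hs).
  assert (Rmin b (c + e / 2) <= c).
  { pose proof (Rmin_l b (c + e / 2)). pose proof (Rmin_r b (c + e / 2)).
    assert (c < Rmin b (c + e / 2)) by (apply Rmin_glb_lt; lra).
    apply Hub. split; [lra |]. intros t Ht.
    destruct (Rlt_or_le t c); [apply Hpos; lra |]. apply Hs. rewrite Rabs_pos_eq; lra. }
  assert (c < Rmin b (c + e / 2)) by (apply Rmin_glb_lt; lra). lra.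
Qed.

Lemma continuous_reflect (v : R -> R) :
  (forall t, continuous v t) -> forall t, continuous (fun t => v (- t)) t.
Proof.
intros Hv t. apply continuous_eps. intros eps Heps.
destruct (proj1 (continuous_eps v (- t)) (Hv (- t)) eps Heps) as (r & Hr & H).
exists r. split; [exact Hr |]. intros s Hs. apply H.
rewrite <- Rabs_Ropp. replace (- (- s - - t)) with (s - t) by ring. exact Hs.
Qed.

Lemma last_zero (v : R -> R) (a b : R) :
  (forall t, continuous v t) -> a < b -> v a = 0 -> 0 < v b ->
  exists c, a <= c < b /\ v c = 0 /\ forall t, c < t <= b -> 0 < v t.
Proof.
intros Hv Hab Ha Hb.
destruct (first_zero (fun t => v (- t)) (- b) (- a)) as (c & Hc & Hc0 & Hpos).
- apply continuous_reflect, Hv.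
- lra.
- rewrite Ropp_involutive. exact Ha.
- destruct (continuous_gt v b 0 (Hv b) Hb) as (r & Hr & H). exists r. split; [exact Hr |].
  intros t Ht. apply H. apply Rabs_def1; lra.
- exists (- c). split; [lra |]. split; [exact Hc0 |]. intros t Ht.
  destruct (Req_dec t b) as [-> | Hne]; [exact Hb |].
  rewrite <- (Ropp_involutive t). apply Hpos. lra.
Qed.

(** * Periodic functions with injective state curve *)

(** On the monotone arc over [[a, b]] the velocity is a function [V] of the position. Along [[s, t]]
    the difference [v - V(x)] goes from negative, at a zero of [v] strictly inside the strip, to
    positive, at the level [x b] where [V] vanishes. Its zero is a common state of the two arcs. *)
Lemma increasing_arcs_meet (x v : R -> R) (a b s t : R) :
  (forall u, is_derive x u (v u)) -> (forall u, continuous v u) ->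
  a < b -> (forall u, a < u < b -> 0 < v u) -> v b = 0 ->
  s < t -> x a < x s < x b -> v s = 0 -> x t = x b -> 0 < v t ->
  (forall u, s <= u <= t -> x a <= x u <= x b) ->
  exists u w, s <= u <= t /\ a <= w <= b /\ x u = x w /\ v u = v w.
Proof.
intros Hx Hv Hab Hpos Hvb Hst Hxs Hvs Hxt Hvt Hin.
assert (Hxc : forall u, continuous x u) by (intros u; apply (is_derive_continuous x u (v u)), Hx).
destruct (increasing_inverse x v a b) as (psi & P1 & P2 & P3 & P4 & _);
  [lra | exact Hxc | auto |].
destruct (intermediate_value (fun u => v u - v (psi (x u))) s t 0) as (u & Hu & Hu0).
- lra.
- intros u. apply (continuous_minus v (fun u => v (psi (x u)))); [apply Hv |].
  apply (continuous_comp (fun u => psi (x u)) v); [| apply Hv].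
  apply (continuous_comp x psi); [apply Hxc | apply P2].
- assert (Ht : v (psi (x t)) = 0) by (rewrite Hxt, P3 by lra; exact Hvb).
  assert (Hs : 0 < v (psi (x s))).
  { apply Hpos. specialize (P1 (x s)). specialize (P4 (x s) ltac:(lra)).
    split; apply Rnot_le_lt; intros H.
    - replace (psi (x s)) with a in P4 by lra. lra.
    - replace (psi (x s)) with b in P4 by lra. lra. }
  rewrite Hvs, Ht, Rmin_left, Rmax_right; lra.
- exists u, (psi (x u)). repeat split.
  + lra.
  + lra.
  + apply P1.
  + apply P1.
  + symmetry. apply P4. apply Hin. lra.
  + lra.
Qed.

Lemma decreasing_arcs_meet (x v : R -> R) (a b s t : R) :
  (forall u, is_derive x u (v u)) -> (forall u, continuous v u) ->
  a < b -> (forall u, a < u < b -> v u < 0) -> v b = 0 ->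
  s < t -> x b < x s < x a -> v s = 0 -> x t = x b -> v t < 0 ->
  (forall u, s <= u <= t -> x b <= x u <= x a) ->
  exists u w, s <= u <= t /\ a <= w <= b /\ x u = x w /\ v u = v w.
Proof.
intros Hx Hv Hab Hneg Hvb Hst Hxs Hvs Hxt Hvt Hin.
destruct (increasing_arcs_meet (fun u => - x u) (fun u => - v u) a b s t)
  as (u & w & Hu & Hw & H1 & H2); try lra.
- intros u. apply (is_derive_opp x u (v u)), Hx.
- intros u. apply (continuous_opp v u), Hv.
- intros u Hu. specialize (Hneg u Hu). lra.
- intros u Hu. specialize (Hin u Hu). lra.
- exists u, w. repeat split; lra.
Qed.

Section Unimodal.

Variables (x v : R -> R) (T : R).
Hypothesis deriv : forall t, is_derive x t (v t).
Hypothesis v_cont : forall t, continuous v t.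
Hypothesis T_pos : 0 < T.
Hypothesis x_per : forall t, x (t + T) = x t.
Hypothesis v_per : forall t, v (t + T) = v t.
Hypothesis injective_state : forall s t, s < t < s + T -> x s = x t -> v s = v t -> False.
(** A change of sign in place of a nonzero derivative: at a passage through the origin the velocity
    need not be differentiable. *)
Hypothesis simple_zeros : forall t, v t = 0 -> exists r, 0 < r /\
  ((forall s, s <> t -> Rabs (s - t) < r -> 0 < v s * (s - t)) \/
   (forall s, s <> t -> Rabs (s - t) < r -> v s * (s - t) < 0)).

Let x_cont t : continuous x t := is_derive_continuous x t (v t) (deriv t).

Lemma critical_point_of_max t : (forall s, x s <= x t) -> v t = 0.
Proof.
intros Hmax.
destruct (Rtotal_order (v t) 0) as [H | [H | H]]; [exfalso | exact H | exfalso].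
- destruct (continuous_lt v t 0 (v_cont t) H) as (r & Hr & Hn).
  assert (x t < x (t - r / 2)); [| specialize (Hmax (t - r / 2)); lra].
  apply (decreasing_of_derive x v (t - r / 2) t); try lra.
  + intros; apply x_cont.
  + intros s Hs. split; [apply deriv |]. apply Hn. apply Rabs_def1; lra.
- destruct (continuous_gt v t 0 (v_cont t) H) as (r & Hr & Hn).
  assert (x t < x (t + r / 2)); [| specialize (Hmax (t + r / 2)); lra].
  apply (increasing_of_derive x v t (t + r / 2)); try lra.
  + intros; apply x_cont.
  + intros s Hs. split; [apply deriv |]. apply Hn. apply Rabs_def1; lra.
Qed.

Lemma sign_change_down t : v t = 0 ->
  (exists l, l < t /\ forall s, l < s < t -> 0 < v s) ->
  exists r, 0 < r /\ forall s, t < s < t + r -> v s < 0.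
Proof.
intros H0 (l & Hl & Hpos).
destruct (simple_zeros t H0) as (r & Hr & [H | H]); exists r; (split; [exact Hr |]); intros s Hs.
- exfalso. set (q := Rmax ((l + t) / 2) (t - r / 2)).
  assert (Hq : q < t) by (apply Rmax_lub_lt; lra).
  pose proof (Rmax_l ((l + t) / 2) (t - r / 2)). pose proof (Rmax_r ((l + t) / 2) (t - r / 2)).
  fold q in H1, H2. specialize (H q ltac:(lra) ltac:(apply Rabs_def1; lra)).
  specialize (Hpos q ltac:(lra)). nra.
- specialize (H s ltac:(lra) ltac:(apply Rabs_def1; lra)). nra.
Qed.

Lemma sign_change_up t : v t = 0 ->
  (exists l, l < t /\ forall s, l < s < t -> v s < 0) ->
  exists r, 0 < r /\ forall s, t < s < t + r -> 0 < v s.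
Proof.
intros H0 (l & Hl & Hpos).
destruct (simple_zeros t H0) as (r & Hr & [H | H]); exists r; (split; [exact Hr |]); intros s Hs.
- specialize (H s ltac:(lra) ltac:(apply Rabs_def1; lra)). nra.
- exfalso. set (q := Rmax ((l + t) / 2) (t - r / 2)).
  assert (Hq : q < t) by (apply Rmax_lub_lt; lra).
  pose proof (Rmax_l ((l + t) / 2) (t - r / 2)). pose proof (Rmax_r ((l + t) / 2) (t - r / 2)).
  fold q in H1, H2. specialize (H q ltac:(lra) ltac:(apply Rabs_def1; lra)).
  specialize (Hpos q ltac:(lra)). nra.
Qed.

(* If [x] rises from [t2] only to [t3] with [x t3 < x t1], the state is trapped
   after [t3] in the strip [x t2 <= x <= x t3]: an exit would have to cross one of
   the arcs described on [[t1, t2]] and [[t2, t3]]. *)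
Lemma spiral_trapped t1 t2 t3 :
  t1 < t2 -> t2 < t3 -> t3 < t1 + T ->
  v t1 = 0 -> v t2 = 0 -> v t3 = 0 ->
  (forall t, t1 < t < t2 -> v t < 0) -> (forall t, t2 < t < t3 -> 0 < v t) ->
  x t3 < x t1 -> False.
Proof.
intros H12 H23 H3T V1 V2 V3 Hneg Hpos Hlt.
assert (X23 : x t2 < x t3).
{ apply (increasing_of_derive x v t2 t3); try lra; intros; [apply x_cont |].
  split; [apply deriv | apply Hpos; assumption]. }
destruct (sign_change_down t3 V3) as (r3 & Hr3 & Hd3).
{ exists t2. split; assumption. }
set (S := fun t => forall s, t3 <= s <= t -> x t2 <= x s <= x t3).
(* The last time, up to [t1 + T], until which the state stays in the strip. It comes before
   [t1 + T], where [x] is back at [x t1], above the strip. *)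
destruct (completeness (fun t => t3 <= t <= t1 + T /\ S t)) as [e [Hub Hlub]].
{ exists (t1 + T). intros q [Hq _]. lra. }
{ exists t3. split; [lra |]. intros s Hs. replace s with t3 by lra. lra. }
assert (He3 : t3 <= e).
{ apply Hub. split; [lra |]. intros s Hs. replace s with t3 by lra. lra. }
assert (HeT : e <= t1 + T) by (apply Hlub; intros q [Hq _]; lra).
assert (Hin' : forall s, t3 <= s < e -> x t2 <= x s <= x t3).
{ intros s Hs. apply NNPP. intros Hn. assert (e <= s); [| lra].
  apply Hlub. intros q [Hq1 Hq2]. apply Rnot_lt_le. intros Hlt'. apply Hn, Hq2. lra. }
assert (He : x t2 <= x e <= x t3).
{ destruct (Req_dec e t3) as [-> | Hne]; [lra |].
  split; apply Rnot_lt_le; intros Hx.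
  - destruct (continuous_lt x e _ (x_cont e) Hx) as (r & Hr & H).
    set (q := Rmax t3 (e - r / 2)).
    assert (q < e) by (apply Rmax_lub_lt; lra).
    pose proof (Rmax_l t3 (e - r / 2)). pose proof (Rmax_r t3 (e - r / 2)). fold q in H1, H2.
    specialize (H q ltac:(apply Rabs_def1; lra)). specialize (Hin' q ltac:(lra)). lra.
  - destruct (continuous_gt x e _ (x_cont e) Hx) as (r & Hr & H).
    set (q := Rmax t3 (e - r / 2)).
    assert (q < e) by (apply Rmax_lub_lt; lra).
    pose proof (Rmax_l t3 (e - r / 2)). pose proof (Rmax_r t3 (e - r / 2)). fold q in H1, H2.
    specialize (H q ltac:(apply Rabs_def1; lra)). specialize (Hin' q ltac:(lra)). lra. }
assert (Hin : forall s, t3 <= s <= e -> x t2 <= x s <= x t3).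
{ intros s Hs. destruct (Req_dec s e) as [-> | ]; [exact He | apply Hin'; lra]. }
assert (HeT' : e < t1 + T).
{ destruct (Req_dec e (t1 + T)) as [-> | ]; [| lra]. rewrite x_per in He. lra. }
assert (Hext : (exists r, 0 < r /\ forall s, e < s < e + r -> x t2 <= x s <= x t3) -> False).
{ intros (r & Hr & Hs). set (q := Rmin (t1 + T) (e + r / 2)).
  assert (e < q) by (apply Rmin_glb_lt; lra).
  pose proof (Rmin_l (t1 + T) (e + r / 2)). pose proof (Rmin_r (t1 + T) (e + r / 2)).
  fold q in H0, H1. assert (q <= e); [| lra].
  apply Hub. split; [lra |]. intros s Hsq.
  destruct (Rle_or_lt s e); [apply Hin; lra | apply Hs; lra]. }
assert (He3' : t3 < e).
{ destruct (Req_dec e t3) as [-> | ]; [exfalso | lra]. apply Hext.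
  destruct (continuous_gt x t3 _ (x_cont t3) X23) as (r & Hr & H).
  exists (Rmin r r3). split; [apply Rmin_pos; assumption |]. intros s Hs.
  pose proof (Rmin_l r r3). pose proof (Rmin_r r r3). split.
  - left. apply H. apply Rabs_def1; lra.
  - left. apply (decreasing_of_derive x v t3 s); try lra; intros; [apply x_cont |].
    split; [apply deriv | apply Hd3; lra]. }
(* Exit through the top. The velocity is positive at [e], so the piece from the last zero of [v] up
   to [e] climbs from inside the strip to the level [x t3] and meets the rising arc over
   [[t2, t3]]. *)
destruct (Req_dec (x e) (x t3)) as [E3 | N3].
- assert (Hve : 0 < v e).
  { destruct (Rtotal_order (v e) 0) as [H | [H | H]]; [exfalso | exfalso | exact H].
    - destruct (continuous_lt v e 0 (v_cont e) H) as (r & Hr & Hn).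
      set (q := Rmax t3 (e - r / 2)).
      assert (q < e) by (apply Rmax_lub_lt; lra).
      pose proof (Rmax_l t3 (e - r / 2)). pose proof (Rmax_r t3 (e - r / 2)). fold q in H1, H2.
      assert (x e < x q).
      { apply (decreasing_of_derive x v q e); try lra; intros; [apply x_cont |].
        split; [apply deriv | apply Hn; apply Rabs_def1; lra]. }
      specialize (Hin q ltac:(lra)). lra.
    - apply (injective_state t3 e); lra. }
  destruct (last_zero v t3 e v_cont He3' V3 Hve) as (s & Hs & Vs & Hsp).
  assert (Hxs : x s < x e).
  { apply (increasing_of_derive x v s e); try lra; intros; [apply x_cont |].
    split; [apply deriv | apply Hsp; lra]. }
  assert (Hxs2 : x s <> x t2).
  { intros H. apply (injective_state t2 s); lra. }
  pose proof (Hin s ltac:(lra)).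
  destruct (increasing_arcs_meet x v t2 t3 s e) as (u & w & Hu & Hw & E1 & E2);
    try assumption; try lra.
  + intros q Hq. apply Hin. lra.
  + destruct (Req_dec u w) as [-> | ].
    * assert (w = t3) by lra. assert (s = t3) by lra. subst s. lra.
    * apply (injective_state w u); lra.
(* Exit through the bottom is the mirror image, with the falling arc over [[t1, t2]]; that arc spans
   the whole strip because [x t3 < x t1]. If [x e] is strictly inside, the state stays in the strip
   a little longer, against the choice of [e]. *)
- destruct (Req_dec (x e) (x t2)) as [E2 | N2].
  + assert (Hve : v e < 0).
    { destruct (Rtotal_order (v e) 0) as [H | [H | H]]; [exact H | exfalso | exfalso].
      - apply (injective_state t2 e); lra.
      - destruct (continuous_gt v e 0 (v_cont e) H) as (r & Hr & Hn).
        set (q := Rmax t3 (e - r / 2)).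
        assert (q < e) by (apply Rmax_lub_lt; lra).
        pose proof (Rmax_l t3 (e - r / 2)). pose proof (Rmax_r t3 (e - r / 2)). fold q in H1, H2.
        assert (x q < x e).
        { apply (increasing_of_derive x v q e); try lra; intros; [apply x_cont |].
          split; [apply deriv | apply Hn; apply Rabs_def1; lra]. }
        specialize (Hin q ltac:(lra)). lra. }
    destruct (last_zero (fun t => - v t) t3 e) as (s & Hs & Vs & Hsp); try lra.
    { intros t. apply (continuous_opp v t), v_cont. }
    assert (Hxs : x e < x s).
    { apply (decreasing_of_derive x v s e); try lra; intros q Hq; [apply x_cont |].
      split; [apply deriv |]. specialize (Hsp q ltac:(lra)). lra. }
    pose proof (Hin s ltac:(lra)).
    destruct (decreasing_arcs_meet x v t1 t2 s e) as (u & w & Hu & Hw & E1 & E3);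
      try assumption; try lra.
    * intros q Hq. specialize (Hin q ltac:(lra)). lra.
    * apply (injective_state w u); lra.
  + apply Hext.
    destruct (continuous_gt x e (x t2) (x_cont e) ltac:(lra)) as (r & Hr & H).
    destruct (continuous_lt x e (x t3) (x_cont e) ltac:(lra)) as (r' & Hr' & H').
    exists (Rmin r r'). split; [apply Rmin_pos; assumption |]. intros s Hs.
    pose proof (Rmin_l r r'). pose proof (Rmin_r r r').
    specialize (H s ltac:(apply Rabs_def1; lra)). specialize (H' s ltac:(apply Rabs_def1; lra)). lra.
Qed.

(** From a maximum, [x] falls up to the next zero [t2] of [v] and rises up to the following one,
    [t3]. If [t3] came before [t1 + T], then either [x t3 = x t1], which repeats a state within a
    period, or [x t3 < x t1], which traps the orbit. *)
Lemma periodic_unimodal t1 : (forall t, x t <= x t1) ->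
  v t1 = 0 /\
  exists t2, t1 < t2 < t1 + T /\ v t2 = 0 /\
    (forall t, t1 < t < t2 -> v t < 0) /\ (forall t, t2 < t < t1 + T -> 0 < v t).
Proof.
intros Hmax.
pose proof (critical_point_of_max t1 Hmax) as V1. split; [exact V1 |].
assert (V1T : v (t1 + T) = 0) by (rewrite v_per; exact V1).
destruct (first_zero (fun t => - v t) t1 (t1 + T)) as (t2 & H2 & V2 & Hneg'); try lra.
{ intros t. apply (continuous_opp v t), v_cont. }
{ destruct (simple_zeros t1 V1) as (r & Hr & [H | H]).
  - exfalso. assert (x t1 < x (t1 + r / 2)); [| specialize (Hmax (t1 + r / 2)); lra].
    apply (increasing_of_derive x v t1 (t1 + r / 2)); try lra; intros s Hs; [apply x_cont |].
    split; [apply deriv |]. specialize (H s ltac:(lra) ltac:(apply Rabs_def1; lra)). nra.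
  - exists r. split; [exact Hr |]. intros s Hs.
    specialize (H s ltac:(lra) ltac:(apply Rabs_def1; lra)). nra. }
assert (Hneg : forall t, t1 < t < t2 -> v t < 0).
{ intros t Ht. specialize (Hneg' t Ht). lra. }
assert (X12 : x t2 < x t1).
{ apply (decreasing_of_derive x v t1 t2); try lra; intros; [apply x_cont |].
  split; [apply deriv | apply Hneg; assumption]. }
assert (H2T : t2 < t1 + T).
{ destruct (Req_dec t2 (t1 + T)) as [-> | ]; [| lra]. rewrite x_per in X12. lra. }
destruct (first_zero v t2 (t1 + T)) as (t3 & H3 & V3 & Hpos); try assumption.
{ apply sign_change_up; [lra |]. exists t1. split; [lra | exact Hneg]. }
exists t2. split; [lra |]. split; [lra |]. split; [exact Hneg |].
destruct (Req_dec t3 (t1 + T)) as [<- | Hne]; [exact Hpos | exfalso].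
destruct (Req_dec (x t3) (x t1)) as [E | N].
- apply (injective_state t1 t3); lra.
- apply (spiral_trapped t1 t2 t3); try assumption; try lra. specialize (Hmax t3). lra.
Qed.

End Unimodal.

(** * Uniqueness for smooth Liénard systems *)

Lemma continuous_bounded (f : R -> R) (a b : R) :
  (forall t, continuous f t) -> exists M, 0 <= M /\ forall t, a <= t <= b -> Rabs (f t) <= M.
Proof.
intros Hf. destruct (Rle_or_lt a b) as [Hab | Hab].
- destruct (continuity_ab_maj (fun t => Rabs (f t)) a b Hab) as (c & Hc & Hcab).
  + intros t _. apply continuity_pt_filterlim. apply (continuous_comp f Rabs).
    * apply Hf.
    * apply continuous_Rabs.
  + exists (Rabs (f c)). split; [apply Rabs_pos | exact Hc].
- exists 0. split; [lra |]. intros; lra.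
Qed.

Definition C1 (f : R -> R) : Prop :=
  exists df, (forall t, is_derive f t (df t)) /\ (forall t, continuous df t).

Lemma C1_continuous f t : C1 f -> continuous f t.
Proof.
intros (df & Hd & _). apply (is_derive_continuous f t (df t)), Hd.
Qed.

Lemma C1_lipschitz (f : R -> R) (M : R) : C1 f ->
  exists K, 0 <= K /\ forall a b, Rabs a <= M -> Rabs b <= M -> Rabs (f a - f b) <= K * Rabs (a - b).
Proof.
intros Hf. pose proof Hf as (df & Hd & Hc).
destruct (continuous_bounded df (- M) M Hc) as (K & HK & Hb).
exists K. split; [exact HK |].
assert (Hlt : forall a b, a < b -> Rabs a <= M -> Rabs b <= M ->
          Rabs (f b - f a) <= K * Rabs (b - a)).
{ intros a b Hab Ha Hbb. apply Rabs_le_between in Ha. apply Rabs_le_between in Hbb.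
  destruct (mean_value f df a b Hab) as (c & Hcab & Hm).
  - intros; apply C1_continuous, Hf.
  - intros; apply Hd.
  - rewrite Hm, Rabs_mult. apply Rmult_le_compat_r; [apply Rabs_pos | apply Hb; lra]. }
intros a b Ha Hbb. destruct (Rtotal_order a b) as [H | [<- | H]].
- rewrite (Rabs_minus_sym (f a)), (Rabs_minus_sym a). apply Hlt; assumption.
- rewrite !Rminus_diag, Rabs_R0. lra.
- apply Hlt; assumption.
Qed.

(** Gronwall for the squared distance. The equations are assumed only for positive times, since at
    time [0] the solutions may sit on the axis, where [y] can have a corner. *)
Lemma lienard_forward_unique (A B x1 y1 x2 y2 : R -> R) (r : R) :
  C1 A -> C1 B -> 0 < r ->
  (forall t, continuous x1 t) -> (forall t, continuous y1 t) ->
  (forall t, continuous x2 t) -> (forall t, continuous y2 t) ->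
  (forall t, 0 < t < r -> is_derive x1 t (A (x1 t) - y1 t) /\ is_derive y1 t (B (x1 t))) ->
  (forall t, 0 < t < r -> is_derive x2 t (A (x2 t) - y2 t) /\ is_derive y2 t (B (x2 t))) ->
  x1 0 = x2 0 -> y1 0 = y2 0 ->
  forall t, 0 <= t <= r -> x1 t = x2 t /\ y1 t = y2 t.
Proof.
intros HA HB Hr Cx1 Cy1 Cx2 Cy2 D1 D2 Ex Ey.
destruct (continuous_bounded x1 0 r Cx1) as (M1 & HM1 & B1).
destruct (continuous_bounded x2 0 r Cx2) as (M2 & HM2 & B2).
destruct (C1_lipschitz A (M1 + M2) HA) as (K1 & HK1 & LA).
destruct (C1_lipschitz B (M1 + M2) HB) as (K2 & HK2 & LB).
(* In the derivative of [X ^ 2 + Y ^ 2], the variation of [A] costs [2 * K1], that of [B] costs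
   [K2], and the cross term [- 2 * X * Y] costs [1]. *)
set (C := 2 * K1 + K2 + 1).
set (W := fun t => ((x1 t - x2 t) ^ 2 + (y1 t - y2 t) ^ 2) * exp (- C * t)).
set (dW := fun t =>
  (2 * (x1 t - x2 t) * ((A (x1 t) - y1 t) - (A (x2 t) - y2 t))
   + 2 * (y1 t - y2 t) * (B (x1 t) - B (x2 t))) * exp (- C * t)
  + ((x1 t - x2 t) ^ 2 + (y1 t - y2 t) ^ 2) * (- C * exp (- C * t))).
assert (HW : forall t, 0 < t <= r -> W t <= W 0).
{ intros t Ht. destruct (mean_value W dW 0 t) as (c & Hc & Hm); [lra | | |].
  - intros s _. unfold W.
    apply (continuous_mult (fun t => (x1 t - x2 t) ^ 2 + (y1 t - y2 t) ^ 2) (fun t => exp (- C * t))).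
    + apply (continuous_plus (fun t => (x1 t - x2 t) ^ 2) (fun t => (y1 t - y2 t) ^ 2)).
      * apply (continuous_comp (fun t => x1 t - x2 t) (fun z => z ^ 2)).
        -- apply (continuous_minus x1 x2); auto.
        -- apply @ex_derive_continuous. auto_derive; auto.
      * apply (continuous_comp (fun t => y1 t - y2 t) (fun z => z ^ 2)).
        -- apply (continuous_minus y1 y2); auto.
        -- apply @ex_derive_continuous. auto_derive; auto.
    + apply @ex_derive_continuous. auto_derive; auto.
  - intros s Hs. destruct (D1 s ltac:(lra)) as [X1 Y1]. destruct (D2 s ltac:(lra)) as [X2 Y2].
    unfold W, dW. auto_derive.
    + repeat split; try (eexists; eassumption).
    + change (Derive (fun z : R => x1 z) s) with (Derive x1 s). change (Derive (fun z : R => x2 z) s) with (Derive x2 s).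
      change (Derive (fun z : R => y1 z) s) with (Derive y1 s). change (Derive (fun z : R => y2 z) s) with (Derive y2 s).
      rewrite (is_derive_unique _ _ _ X1), (is_derive_unique _ _ _ X2),
        (is_derive_unique _ _ _ Y1), (is_derive_unique _ _ _ Y2). ring.
  - assert (dW c <= 0); [| nra].
    assert (Hc1 : Rabs (x1 c) <= M1 + M2) by (specialize (B1 c ltac:(lra)); lra).
    assert (Hc2 : Rabs (x2 c) <= M1 + M2) by (specialize (B2 c ltac:(lra)); lra).
    specialize (LA _ _ Hc1 Hc2). specialize (LB _ _ Hc1 Hc2).
    unfold dW. pose proof (exp_pos (- C * c)) as Hexp.
    set (X := x1 c - x2 c) in *. set (Y := y1 c - y2 c) in *.
    replace (A (x1 c) - y1 c - (A (x2 c) - y2 c)) with ((A (x1 c) - A (x2 c)) - Y) by (unfold Y; ring).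
    set (a := A (x1 c) - A (x2 c)) in *. set (b := B (x1 c) - B (x2 c)) in *.
    assert (Hmain : 2 * X * (a - Y) + 2 * Y * b <= C * (X ^ 2 + Y ^ 2)).
    { assert (X * a <= K1 * X ^ 2).
      { apply Rle_trans with (Rabs X * Rabs a).
        - rewrite <- Rabs_mult. apply Rle_abs.
        - rewrite <- (pow2_abs X). pose proof (Rabs_pos X). nra. }
      assert (Y * b <= K2 * (Rabs X * Rabs Y)).
      { apply Rle_trans with (Rabs Y * Rabs b).
        - rewrite <- Rabs_mult. apply Rle_abs.
        - pose proof (Rabs_pos Y). nra. }
      assert (2 * (Rabs X * Rabs Y) <= X ^ 2 + Y ^ 2).
      { rewrite <- (pow2_abs X), <- (pow2_abs Y). pose proof (pow2_ge_0 (Rabs X - Rabs Y)). lra. }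
      assert (- (2 * X * Y) <= X ^ 2 + Y ^ 2) by (pose proof (pow2_ge_0 (X + Y)); lra).
      pose proof (pow2_ge_0 X). pose proof (pow2_ge_0 Y).
      assert (2 * (K2 * (Rabs X * Rabs Y)) <= K2 * (X ^ 2 + Y ^ 2)) by nra.
      assert (0 <= K1 * Y ^ 2) by (apply Rmult_le_pos; assumption).
      unfold C. lra. }
    nra. }
intros t Ht. destruct (Req_dec t 0) as [-> | Hne]; [split; assumption |].
specialize (HW t ltac:(lra)). unfold W in HW. rewrite Ex, Ey in HW.
pose proof (exp_pos (- C * t)).
replace (((x2 0 - x2 0) ^ 2 + (y2 0 - y2 0) ^ 2) * exp (- C * 0)) with 0 in HW by ring.
pose proof (pow2_ge_0 (x1 t - x2 t)). pose proof (pow2_ge_0 (y1 t - y2 t)).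
assert (Hs : (x1 t - x2 t) ^ 2 + (y1 t - y2 t) ^ 2 <= 0) by nra.
split; apply Rminus_diag_uniq; apply Rsqr_0_uniq; rewrite Rsqr_pow2; lra.
Qed.

Lemma periodic_IZR (f : R -> R) (T : R) : (forall t, f (t + T) = f t) ->
  forall (k : Z) t, f (t + IZR k * T) = f t.
Proof.
intros Hf.
assert (Hn : forall (n : nat) t, f (t + INR n * T) = f t).
{ induction n as [| n IH]; intros t.
  - simpl. f_equal. ring.
  - rewrite S_INR. replace (t + (INR n + 1) * T) with ((t + INR n * T) + T) by ring.
    rewrite Hf. apply IH. }
intros k t. destruct (Z.le_gt_cases 0 k) as [Hk | Hk].
- rewrite <- (Z2Nat.id k), <- INR_IZR_INZ by lia. apply Hn.
- rewrite <- (Hn (Z.to_nat (- k)) (t + IZR k * T)). f_equal.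
  rewrite INR_IZR_INZ, Z2Nat.id, opp_IZR by lia. ring.
Qed.

Lemma sign_change_of_derive (w : R -> R) (t d : R) :
  is_derive w t d -> w t = 0 -> d <> 0 ->
  exists r, 0 < r /\ forall s, s <> t -> Rabs (s - t) < r -> 0 < d * (w s * (s - t)).
Proof.
intros Hd H0 Hne. apply is_derive_Reals in Hd.
destruct (Hd (Rabs d / 2)) as (r & Hr).
{ pose proof (Rabs_pos_lt d Hne). lra. }
exists r. split; [apply cond_pos |]. intros s Hs Hsr.
specialize (Hr (s - t) ltac:(lra) Hsr). replace (t + (s - t)) with s in Hr by ring.
rewrite H0, Rminus_0_r in Hr. set (q := w s / (s - t)) in *.
replace (w s * (s - t)) with (q * (s - t) ^ 2) by (unfold q; field; lra).
assert (0 < (s - t) ^ 2) by (apply pow2_gt_0; lra).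
assert (0 < d * q).
{ destruct (Rlt_or_le 0 d) as [Hp | Hp].
  - rewrite (Rabs_pos_eq d) in Hr by lra. apply Rabs_def2 in Hr. nra.
  - rewrite (Rabs_left1 d) in Hr by lra. apply Rabs_def2 in Hr. nra. }
rewrite <- Rmult_assoc. apply Rmult_lt_0_compat; assumption.
Qed.

Lemma shift_continuous (f : R -> R) (a : R) : (forall t, continuous f t) -> forall t, continuous (fun t => f (a + t)) t.
Proof.
intros Hf t. apply continuous_eps. intros eps Heps.
destruct (proj1 (continuous_eps f (a + t)) (Hf (a + t)) eps Heps) as (r & Hr & H).
exists r. split; [exact Hr |]. intros s Hs. apply H. replace (a + s - (a + t)) with (s - t) by ring. exact Hs.
Qed.

Lemma shift_derive (f : R -> R) (a t d : R) : is_derive f (a + t) d -> is_derive (fun t => f (a + t)) t d.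
Proof.
intros H. rewrite <- (Rmult_1_l d). apply (is_derive_comp f (fun t => a + t)); [exact H |].
auto_derive; [trivial | ring].
Qed.

Lemma continuous_eq_left (f g : R -> R) z c : c < z ->
  (forall t, continuous f t) -> (forall t, continuous g t) ->
  (forall t, c <= t < z -> f t = g t) -> f z = g z.
Proof.
intros Hcz Hf Hg H. apply Rminus_diag_uniq. set (h := fun t => f t - g t). change (h z = 0).
assert (Hc : continuous h z) by (apply (continuous_minus f g); auto).
destruct (Req_dec (h z) 0) as [E | N]; [exact E | exfalso].
destruct (proj1 (continuous_eps h z) Hc (Rabs (h z)) (Rabs_pos_lt _ N)) as (r & Hr & Hs).
set (q := Rmax c (z - r / 2)). assert (q < z) by (apply Rmax_lub_lt; lra).
pose proof (Rmax_l c (z - r / 2)). pose proof (Rmax_r c (z - r / 2)). fold q in H1, H2.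
specialize (Hs q ltac:(apply Rabs_def1; lra)). unfold h at 1 in Hs. rewrite (H q) in Hs by lra.
rewrite Rminus_diag, Rminus_0_l, Rabs_Ropp in Hs. lra.
Qed.

Lemma period_reduce (T s t : R) : 0 < T -> exists k : Z, s <= t + IZR k * T < s + T.
Proof.
intros HT. exists (Z.opp (Int_part ((t - s) / T))). rewrite opp_IZR.
destruct (base_Int_part ((t - s) / T)) as [K1 K2].
assert (E : t - s = (t - s) / T * T) by (field; lra).
assert (K3 : (t - s) / T < IZR (Int_part ((t - s) / T)) + 1) by lra.
apply Rmult_le_compat_r with (r := T) in K1; [| lra].
apply Rmult_lt_compat_r with (r := T) in K3; [| lra]. lra.
Qed.

(** * Winding numbers *)

(** [Y / (r + X)] is the tangent of half the polar angle. This gives one continuous formula off the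
    negative [X]-axis, hence on the whole punctured half-plane [0 <= X]. *)
Lemma half_angle (X Y r : R) : 0 < r -> r ^ 2 = X ^ 2 + Y ^ 2 -> 0 < r + X ->
  X = r * cos (2 * atan (Y / (r + X))) /\ Y = r * sin (2 * atan (Y / (r + X))).
Proof.
intros Hr Hr2 Hp. set (u := Y / (r + X)).
rewrite cos_2a_cos, sin_2a, cos_atan, sin_atan.
assert (Hu : 1 + Rsqr u = 2 * r / (r + X)).
{ unfold u, Rsqr. apply Rmult_eq_reg_r with ((r + X) * (r + X)); [| nra].
  replace ((1 + Y / (r + X) * (Y / (r + X))) * ((r + X) * (r + X))) with ((r + X) * (r + X) + Y * Y) by (field; lra).
  replace (2 * r / (r + X) * ((r + X) * (r + X))) with (2 * r * (r + X)) by (field; lra). nra. }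
assert (Hpos : 0 < 1 + Rsqr u) by (pose proof (Rle_0_sqr u); lra).
assert (Hs : sqrt (1 + Rsqr u) <> 0) by (apply Rgt_not_eq, sqrt_lt_R0, Hpos).
assert (Hss : sqrt (1 + Rsqr u) * sqrt (1 + Rsqr u) = 2 * r / (r + X)) by (rewrite <- Hu; apply sqrt_def; lra).
set (q := sqrt (1 + Rsqr u)) in *.
split.
- replace (2 * (1 / q) * (1 / q) - 1) with (2 / (q * q) - 1) by (field; exact Hs).
  rewrite Hss. field. split; lra.
- replace (2 * (u / q) * (1 / q)) with (2 * u / (q * q)) by (field; exact Hs).
  rewrite Hss. unfold u. field. split; lra.
Qed.

Lemma clamp_continuous a b t : continuous (clamp a b) t.
Proof.
apply continuous_eps. intros eps Heps. exists eps. split; [exact Heps |].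
intros s Hs. eapply Rle_lt_trans; [| exact Hs].
unfold clamp, Rmin, Rmax, Rabs. repeat destruct Rle_dec; repeat destruct Rcase_abs; lra.
Qed.

Lemma clamp_low a b t : a <= b -> t <= a -> clamp a b t = a.
Proof. intros. unfold clamp. rewrite Rmax_right, Rmin_left; lra. Qed.

Lemma clamp_high a b t : a <= b -> b <= t -> clamp a b t = b.
Proof. intros. unfold clamp. rewrite Rmax_left, Rmin_right; lra. Qed.

(* The extension of a function that is constant outside one cell [[s, s + T]]: near
   the common end of two cells it is the sum of two consecutive branches, up to a
   constant. *)
Lemma quasi_periodic_extension (th0 : R -> R) (s T a D : R) :
  0 < T -> (forall t, continuous th0 t) ->
  (forall t, t <= s -> th0 t = a) -> (forall t, s + T <= t -> th0 t = a + D) ->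
  forall t, continuous (fun t => th0 (t - IZR (Int_part ((t - s) / T)) * T)
                                 + D * IZR (Int_part ((t - s) / T))) t.
Proof.
intros HT Hc Hlo Hhi t.
set (k := Int_part ((t - s) / T)).
assert (Hcell : forall (j : Z) q, s + IZR j * T <= q < s + (IZR j + 1) * T -> Int_part ((q - s) / T) = j).
{ intros j q Hq. symmetry. apply Int_part_spec. split.
  - apply Rmult_lt_reg_r with T; [exact HT |]. unfold Rdiv.
    rewrite Rmult_minus_distr_r, Rmult_assoc, Rinv_l, Rmult_1_r by lra. lra.
  - apply Rmult_le_reg_r with T; [exact HT |]. unfold Rdiv.
    rewrite Rmult_assoc, Rinv_l, Rmult_1_r by lra. lra. }
assert (Hk : s + IZR k * T <= t < s + (IZR k + 1) * T).
{ destruct (base_Int_part ((t - s) / T)) as [H1 H2]. fold k in H1, H2.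
  assert (E : t - s = (t - s) / T * T) by (field; lra).
  split.
  - apply Rmult_le_compat_r with (r := T) in H1; lra.
  - assert (H3 : (t - s) / T < IZR k + 1) by lra.
    apply Rmult_lt_compat_r with (r := T) in H3; lra. }
assert (Hbr : forall j : Z, continuous (fun q => th0 (q - IZR j * T)) t).
{ intros j. apply continuous_eps. intros eps Heps.
  destruct (proj1 (continuous_eps th0 (t - IZR j * T)) (Hc _) eps Heps) as (r & Hr & H).
  exists r. split; [exact Hr |]. intros q Hq. apply H.
  replace (q - IZR j * T - (t - IZR j * T)) with (q - t) by ring. exact Hq. }
apply continuous_ext_loc with
  (fun q => th0 (q - IZR k * T) + th0 (q - IZR (k - 1) * T) + (D * IZR (k - 1) - a)).
- exists (mkposreal (Rmin T (s + (IZR k + 1) * T - t)) ltac:(apply Rmin_pos; lra)).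
  intros q Hq. match goal with |- ?l = ?r => change (@eq R l r) end. assert (Hq' : Rabs (q - t) < Rmin T (s + (IZR k + 1) * T - t)) by exact Hq.
  pose proof (Rmin_l T (s + (IZR k + 1) * T - t)). pose proof (Rmin_r T (s + (IZR k + 1) * T - t)).
  assert (Hq2 : Rabs (q - t) < T /\ Rabs (q - t) < s + (IZR k + 1) * T - t) by lra.
  destruct Hq2 as [Ha Hb]. apply Rabs_def2 in Ha. apply Rabs_def2 in Hb.
  assert (Hk1 : IZR (k - 1) = IZR k - 1) by apply minus_IZR.
  destruct (Rle_or_lt (s + IZR k * T) q) as [Hle | Hlt].
  + rewrite (Hcell k q) by lra. rewrite (Hhi (q - IZR (k - 1) * T)) by (rewrite Hk1; lra).
    rewrite Hk1. ring.
  + rewrite (Hcell (k - 1)%Z q) by (rewrite Hk1; lra). rewrite (Hlo (q - IZR k * T)) by lra. ring.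
- apply (continuous_plus (fun q => th0 (q - IZR k * T) + th0 (q - IZR (k - 1) * T))
           (fun _ => D * IZR (k - 1) - a)); [| apply continuous_const].
  apply (continuous_plus (fun q => th0 (q - IZR k * T)) (fun q => th0 (q - IZR (k - 1) * T))); apply Hbr.
Qed.

(** The curve passes from below to above the centre within the right half-plane and returns within
    the left one. With [Rabs X] in the half-angle formula, [g] is the angle on the right and
    [PI - g] the angle on the left, so the angle runs from [- PI / 2] through [PI / 2] to
    [3 * PI / 2]. *)
Lemma winds_once (x y : R -> R) (T c d s1 s0 : R) :
  (forall t, continuous x t) -> (forall t, continuous y t) ->
  (forall t, x (t + T) = x t) -> (forall t, y (t + T) = y t) ->
  s1 < s0 < s1 + T ->
  (forall t, x t = c -> y t <> d) ->
  x s1 = c -> y s1 < d -> x s0 = c -> d < y s0 ->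
  (forall t, s1 <= t <= s0 -> c <= x t) -> (forall t, s0 <= t <= s1 + T -> x t <= c) ->
  surrounds_counterclockwise x y T (c, d).
Proof.
intros Cx Cy Px Py Hs Hav X1 Y1 X0 Y0 Hright Hleft.
assert (HT : 0 < T) by lra.
set (X := fun t => x t - c). set (Y := fun t => y t - d).
set (r := fun t => sqrt (X t ^ 2 + Y t ^ 2)).
assert (CX : forall t, continuous X t).
{ intros t. apply (continuous_minus x (fun _ => c)); [apply Cx | apply continuous_const]. }
assert (CY : forall t, continuous Y t).
{ intros t. apply (continuous_minus y (fun _ => d)); [apply Cy | apply continuous_const]. }
assert (Hpos : forall t, 0 < X t ^ 2 + Y t ^ 2).
{ intros t. pose proof (pow2_ge_0 (X t)). pose proof (pow2_ge_0 (Y t)).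
  destruct (Req_dec (X t) 0) as [E | N].
  - assert (Y t <> 0). { unfold X, Y in *. specialize (Hav t). lra. }
    pose proof (pow2_gt_0 (Y t) H1). lra.
  - pose proof (pow2_gt_0 (X t) N). lra. }
assert (Hr : forall t, 0 < r t) by (intros; apply sqrt_lt_R0, Hpos).
assert (Hr2 : forall t, r t ^ 2 = X t ^ 2 + Y t ^ 2) by (intros; apply pow2_sqrt; left; apply Hpos).
assert (Cr : forall t, continuous r t).
{ intros t. apply (continuous_comp (fun t => X t ^ 2 + Y t ^ 2) sqrt); [| apply continuous_sqrt].
  apply (continuous_plus (fun t => X t ^ 2) (fun t => Y t ^ 2)).
  - apply (continuous_comp X (fun z => z ^ 2)); [apply CX |].
    apply @ex_derive_continuous. auto_derive; trivial.
  - apply (continuous_comp Y (fun z => z ^ 2)); [apply CY |].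
    apply @ex_derive_continuous. auto_derive; trivial. }
set (g := fun t => 2 * atan (Y t / (r t + Rabs (X t)))).
assert (Hden : forall t, 0 < r t + Rabs (X t)) by (intros t; pose proof (Hr t); pose proof (Rabs_pos (X t)); lra).
assert (Cg : forall t, continuous g t).
{ intros t. apply (continuous_scal_r 2 (fun t => atan (Y t / (r t + Rabs (X t))))).
  apply (continuous_comp (fun t => Y t / (r t + Rabs (X t))) atan).
  - apply (continuous_mult Y (fun t => / (r t + Rabs (X t)))); [apply CY |].
    apply (continuous_comp (fun t => r t + Rabs (X t)) Rinv).
    + apply (continuous_plus r (fun t => Rabs (X t))); [apply Cr |].
      apply (continuous_comp X Rabs); [apply CX | apply continuous_Rabs].
    + apply continuous_Rinv. apply Rgt_not_eq, Hden.
  - apply continuity_pt_filterlim. apply derivable_continuous_pt, derivable_pt_atan. }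
assert (Hend : forall t, X t = 0 -> r t = Rabs (Y t)).
{ intros t E. unfold r. rewrite E. replace (0 ^ 2 + Y t ^ 2) with (Rsqr (Y t)) by (unfold Rsqr; ring).
  apply sqrt_Rsqr_abs. }
assert (G0 : g s0 = PI / 2).
{ assert (E : X s0 = 0) by (unfold X; lra). assert (0 < Y s0) by (unfold Y; lra).
  unfold g. rewrite (Hend s0 E), E, Rabs_R0, Rplus_0_r, Rabs_pos_eq by lra.
  replace (Y s0 / Y s0) with 1 by (field; lra). rewrite atan_1. field. }
assert (G1 : g s1 = - (PI / 2)).
{ assert (E : X s1 = 0) by (unfold X; lra). assert (Y s1 < 0) by (unfold Y; lra).
  unfold g. rewrite (Hend s1 E), E, Rabs_R0, Rplus_0_r, Rabs_left by lra.
  replace (Y s1 / - Y s1) with (- (1)) by (field; lra). rewrite atan_opp, atan_1. field. }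
assert (G2 : g (s1 + T) = g s1).
{ unfold g, r, X, Y. rewrite Px, Py. reflexivity. }
(* The two formulas are concatenated by freezing: up to [s0] the second summand is [0], and after
   [s0] the first is [PI / 2], so that the sum is [PI - g]. *)
set (th0 := fun t => g (clamp s1 s0 t) + (PI / 2 - g (clamp s0 (s1 + T) t))).
set (k := fun t => Int_part ((t - s1) / T)).
exists r, (fun t => th0 (t - IZR (k t) * T) + 2 * PI * IZR (k t)).
split; [| split].
- apply (quasi_periodic_extension th0 s1 T (- (PI / 2)) (2 * PI)).
  + exact HT.
  + intros t. apply (continuous_plus (fun t => g (clamp s1 s0 t)) (fun t => PI / 2 - g (clamp s0 (s1 + T) t))).
    * apply (continuous_comp (clamp s1 s0) g); [apply clamp_continuous | apply Cg].
    * apply (continuous_minus (fun _ => PI / 2) (fun t => g (clamp s0 (s1 + T) t))); [apply continuous_const |].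
      apply (continuous_comp (clamp s0 (s1 + T)) g); [apply clamp_continuous | apply Cg].
  + intros t Ht. unfold th0. rewrite !clamp_low, G0, G1 by lra. ring.
  + intros t Ht. unfold th0. rewrite !clamp_high, G0, G2, G1 by lra. field.
- intros t. split; [apply Hr |]. cbn [fst snd].
  destruct (base_Int_part ((t - s1) / T)) as [K1 K2]. fold (k t) in K1, K2.
  set (q := t - IZR (k t) * T).
  assert (Hq : s1 <= q < s1 + T).
  { assert (E : t - s1 = (t - s1) / T * T) by (field; lra). unfold q.
    assert (K3 : (t - s1) / T < IZR (k t) + 1) by lra.
    apply Rmult_le_compat_r with (r := T) in K1; [| lra].
    apply Rmult_lt_compat_r with (r := T) in K3; [| lra]. lra. }
  assert (Hper : forall f : R -> R, (forall t, f (t + T) = f t) -> f t = f q).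
  { intros f Hf. rewrite <- (periodic_IZR f T Hf (k t) q). f_equal. unfold q. ring. }
  assert (Eq : x t = x q /\ y t = y q /\ r t = r q).
  { split; [apply Hper, Px |]. split; [apply Hper, Py |]. apply Hper.
    intros u. unfold r, X, Y. rewrite Px, Py. reflexivity. }
  destruct Eq as (Ex & Ey & Er). rewrite Ex, Ey, Er.
  assert (Hcos : forall u, cos (u + 2 * PI) = cos u) by (intros u; rewrite cos_plus, cos_2PI, sin_2PI; ring).
  assert (Hsin : forall u, sin (u + 2 * PI) = sin u) by (intros u; rewrite sin_plus, cos_2PI, sin_2PI; ring).
  rewrite (Rmult_comm (2 * PI)), (periodic_IZR cos _ Hcos), (periodic_IZR sin _ Hsin).
  pose proof (Hr q) as Hrq. pose proof (Hr2 q) as Hr2q. pose proof (Hden q) as Hdq.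
  destruct (Rle_or_lt q s0) as [Hle | Hlt].
  + assert (HX : 0 <= X q) by (unfold X; specialize (Hright q ltac:(lra)); lra).
    assert (E : th0 q = g q).
    { unfold th0. rewrite clamp_id, clamp_low, G0 by lra. ring. }
    rewrite E. unfold g. rewrite Rabs_pos_eq in * by exact HX.
    destruct (half_angle (X q) (Y q) (r q)) as [A1 A2]; try assumption.
    rewrite <- A1, <- A2. unfold X, Y. split; ring.
  + assert (HX : X q <= 0) by (unfold X; specialize (Hleft q ltac:(lra)); lra).
    assert (E : th0 q = PI - g q).
    { unfold th0. rewrite clamp_high, clamp_id, G0 by lra. field. }
    rewrite E. replace (cos (PI - g q)) with (- cos (g q)) by (rewrite cos_minus, cos_PI, sin_PI; ring).
    replace (sin (PI - g q)) with (sin (g q)) by (rewrite sin_minus, cos_PI, sin_PI; ring).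
    unfold g. rewrite Rabs_left1 in * by exact HX.
    destruct (half_angle (- X q) (Y q) (r q)) as [A1 A2]; try assumption.
    { rewrite Hr2q. ring. }
    rewrite <- A2. rewrite <- Ropp_mult_distr_r, <- A1. unfold X, Y. split; ring.
- assert (Hk : k T = Z.add (k 0%R) 1%Z).
  { unfold k. symmetry. apply Int_part_spec. rewrite plus_IZR.
    destruct (base_Int_part ((0 - s1) / T)%R) as [K1 K2].
    replace ((T - s1) / T) with ((0 - s1) / T + 1) by (field; lra). lra. }
  rewrite Hk, plus_IZR. replace (T - (IZR (k 0%R) + 1) * T) with (0 - IZR (k 0%R) * T) by ring. ring.
Qed.

(** * Half orbits in the plane of [p] *)

(** [W] is the velocity as a function of [p]. Its half square is differentiated because [W * W'] is
    the left-hand side of [x' dx'/dp = x' - h], which involves no division by the vanishing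
    velocity. *)
Lemma branch_increasing (P dP w dw : R -> R) (a b : R) :
  a <= b -> (forall t, continuous P t) -> (forall t, continuous w t) ->
  (forall t, a < t < b -> is_derive P t (dP t) /\ 0 < dP t) ->
  (forall t, a < t < b -> is_derive w t (dw t)) ->
  exists W : R -> R,
    (forall p, continuous W p) /\ W (P a) = w a /\ W (P b) = w b /\
    forall p, P a < p < P b -> exists t, a < t < b /\ P t = p /\ W p = w t /\
      is_derive (fun q => W q ^ 2 / 2) p (w t * (dw t / dP t)).
Proof.
intros Hab CP Cw DP Dw.
destruct (increasing_inverse P dP a b Hab CP DP) as (psi & H1 & H2 & H3 & H4 & H5).
exists (fun p => w (psi p)). split; [| split; [| split]].
- intros p. apply (continuous_comp psi w); [apply H2 | apply Cw].
- rewrite H3 by lra. reflexivity.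
- rewrite H3 by lra. reflexivity.
- intros p Hp. specialize (H1 p). specialize (H4 p ltac:(lra)).
  set (t := psi p) in *.
  assert (Ht : a < t < b).
  { split; apply Rnot_le_lt; intros H.
    - replace t with a in H4 by lra. lra.
    - replace t with b in H4 by lra. lra. }
  exists t. split; [exact Ht |]. split; [exact H4 |]. split; [reflexivity |].
  specialize (H5 t Ht). rewrite H4 in H5. destruct (DP t Ht) as [_ Hpos].
  pose proof (is_derive_comp w psi p _ _ (Dw t Ht) H5) as HW.
  replace (w t * (dw t / dP t)) with (/ dP t * dw t * w t) by (field; lra).
  assert (Hsq : is_derive (fun z => z ^ 2 / 2) (w (psi p)) (w t)).
  { auto_derive; [trivial |]. unfold t. field. }
  exact (is_derive_comp (fun z => z ^ 2 / 2) (fun q => w (psi q)) p _ _ Hsq HW).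
Qed.

Lemma reflect_derive (f : R -> R) (t d : R) :
  is_derive f (- t) d -> is_derive (fun t => f (- t)) t (- d).
Proof.
intros H. replace (- d) with ((-1) * d) by ring.
apply (is_derive_comp f (fun t => - t)); [exact H |]. auto_derive; [trivial | ring].
Qed.

Lemma branch_decreasing (P dP w dw : R -> R) (a b : R) :
  a <= b -> (forall t, continuous P t) -> (forall t, continuous w t) ->
  (forall t, a < t < b -> is_derive P t (dP t) /\ dP t < 0) ->
  (forall t, a < t < b -> is_derive w t (dw t)) ->
  exists W : R -> R,
    (forall p, continuous W p) /\ W (P a) = w a /\ W (P b) = w b /\
    forall p, P b < p < P a -> exists t, a < t < b /\ P t = p /\ W p = w t /\
      is_derive (fun q => W q ^ 2 / 2) p (w t * (dw t / dP t)).
Proof.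
intros Hab CP Cw DP Dw.
destruct (branch_increasing (fun t => P (- t)) (fun t => - dP (- t)) (fun t => w (- t)) (fun t => - dw (- t))
  (- b) (- a)) as (W & H1 & H2 & H3 & H4).
- lra.
- apply continuous_reflect, CP.
- apply continuous_reflect, Cw.
- intros t Ht. destruct (DP (- t)) as [D N]; [lra |]. split; [| lra].
  apply reflect_derive, D.
- intros t Ht. apply reflect_derive, Dw. lra.
- rewrite !Ropp_involutive in *. exists W. repeat split; try assumption.
  intros p Hp. destruct (H4 p Hp) as (t & Ht & E1 & E2 & Hd).
  exists (- t). split; [lra |]. split; [exact E1 |]. split; [exact E2 |].
  destruct (DP (- t)) as [_ N]; [lra |].
  replace (dw (- t) / dP (- t)) with (- dw (- t) / - dP (- t)) by (field; lra). exact Hd.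
Qed.

(* [a ^ 2 - b ^ 2 = (a - b) (a + b)] and [a + b] is bounded below near [0], so that
   Gronwall's lemma applies to [(a ^ 2 - b ^ 2) / 2]. *)
Lemma branch_comparison (a b da db : R -> R) (m : R) :
  (forall p, continuous a p) -> (forall p, continuous b p) ->
  a 0 = b 0 -> (forall p, 0 <= p < m -> 0 < a p /\ 0 < b p) ->
  (forall p, 0 < p < m -> is_derive (fun q => a q ^ 2 / 2) p (da p) /\
                          is_derive (fun q => b q ^ 2 / 2) p (db p)) ->
  (forall p, 0 < p < m -> a p <= b p -> a p - b p < da p - db p) ->
  forall p, 0 < p < m -> b p < a p.
Proof.
intros Ca Cb E0 Hpos Hd Hcmp.
set (w := fun p => a p ^ 2 / 2 - b p ^ 2 / 2).
assert (Csq : forall f : R -> R, (forall p, continuous f p) -> forall p, continuous (fun q => f q ^ 2 / 2) p).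
{ intros f Cf p. apply (continuous_comp f (fun z => z ^ 2 / 2)); [apply Cf |].
  apply @ex_derive_continuous. auto_derive; trivial. }
assert (Cw : forall p, continuous w p).
{ intros p. apply (continuous_minus (fun q => a q ^ 2 / 2) (fun q => b q ^ 2 / 2)); apply Csq; assumption. }
assert (Dw : forall p, 0 < p < m -> is_derive w p (da p - db p)).
{ intros p Hp. destruct (Hd p Hp) as [D1 D2].
  exact (is_derive_minus (fun q => a q ^ 2 / 2) (fun q => b q ^ 2 / 2) p _ _ D1 D2). }
assert (W0 : w 0 = 0) by (unfold w; rewrite E0; ring).
assert (Hw : forall p, 0 <= p < m -> w p = (a p - b p) * (a p + b p) / 2) by (intros; unfold w; field).
assert (Hge : forall p, 0 < p < m -> 0 <= w p).
{ intros p Hp. apply Rnot_lt_le. intros Hneg.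
  (* After its last zero [q], [w] is negative, hence [a < b] and [k * w <= a - b < w'], with [2 / k]
     the minimum of [a + b] on [[0, p]]. Then [w * exp (- k * t)] increases from [0], contradicting
     [w p < 0]. *)
  destruct (last_zero (fun t => - w t) 0 p) as (q & Hq & Wq & Hlt); try lra.
  { intros t. apply (continuous_opp w t), Cw. }
  destruct (continuity_ab_min (fun t => a t + b t) 0 p) as (z & Hz & Hz0); [lra | |].
  { intros c _. apply continuity_pt_filterlim. apply (continuous_plus a b); auto. }
  set (k := 2 / (a z + b z)).
  assert (Hsz : 0 < a z + b z) by (destruct (Hpos z); lra).
  assert (Hk : 0 < k) by (apply Rdiv_lt_0_compat; lra).
  assert (Hinc : w q * exp (- k * q) < w p * exp (- k * p)).
  { apply (increasing_of_derive (fun t => w t * exp (- k * t))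
       (fun t => (da t - db t) * exp (- k * t) + w t * (- k * exp (- k * t))) q p); try lra.
    - intros t _. apply (continuous_mult w (fun t => exp (- k * t))); [apply Cw |].
      apply @ex_derive_continuous. auto_derive; trivial.
    - intros t Ht. split.
      + apply (is_derive_mult w (fun t => exp (- k * t))); [apply Dw; lra | | intros; apply Rmult_comm].
        auto_derive; [trivial | ring].
      + specialize (Hlt t ltac:(lra)). pose proof (Hw t ltac:(lra)) as Ew.
        destruct (Hpos t ltac:(lra)) as [Pa Pb].
        assert (Hab : a t < b t) by nra.
        specialize (Hcmp t ltac:(lra) ltac:(lra)).
        assert (Hz1 : a z + b z <= a t + b t) by (apply Hz; lra).
        assert (Hkw : k * w t <= a t - b t).
        { rewrite Ew. unfold k. apply Rmult_le_reg_r with (a z + b z); [exact Hsz |].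
          replace (2 / (a z + b z) * ((a t - b t) * (a t + b t) / 2) * (a z + b z))
            with ((a t - b t) * (a t + b t)) by (field; lra). nra. }
        pose proof (exp_pos (- k * t)). nra. }
  replace (w q) with 0 in Hinc by lra. pose proof (exp_pos (- k * p)). nra. }
(* The weak inequality is known by now. Equality at [p] would make the derivative of [w] positive at
   a zero of [w], so [w] would be negative just before [p]. *)
intros p Hp. apply Rnot_le_lt. intros Hle.
destruct (Hpos p ltac:(lra)) as [Pa Pb].
pose proof (Hge p Hp). pose proof (Hw p ltac:(lra)) as Ew.
assert (Wp : w p = 0) by nra.
specialize (Hcmp p Hp Hle).
assert (Eab : a p = b p) by nra.
destruct (sign_change_of_derive w p _ (Dw p Hp) Wp ltac:(lra)) as (r & Hr & Hs).
set (q := Rmax (p / 2) (p - r / 2)).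
assert (q < p) by (apply Rmax_lub_lt; lra).
pose proof (Rmax_l (p / 2) (p - r / 2)). pose proof (Rmax_r (p / 2) (p - r / 2)). fold q in H1, H2.
specialize (Hs q ltac:(lra) ltac:(apply Rabs_def1; lra)).
specialize (Hge q ltac:(lra)).
assert (0 < w q * (q - p)) by nra. nra.
Qed.

(* In the plane of [p] and [x' = p - y], a half orbit consists of a lower branch
   [x' = l] and an upper branch [x' = - u], and [l ^ 2 - u ^ 2] does not depend on
   the dominated quantity [h]. *)
Definition half_orbit (l u h : R -> R) (m : R) : Prop :=
  0 < m /\ (forall p, continuous l p) /\ (forall p, continuous u p) /\
  l m = 0 /\ u m = 0 /\ 0 < l 0 /\ 0 < u 0 /\
  forall p, 0 < p < m -> 0 < l p /\ 0 < u p /\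
    is_derive (fun q => l q ^ 2 / 2) p (l p - h p) /\
    is_derive (fun q => u q ^ 2 / 2) p (- u p - h p).

Lemma half_orbits_not_ordered (l1 u1 h1 l2 u2 h2 : R -> R) (m1 m2 : R) :
  half_orbit l1 u1 h1 m1 -> half_orbit l2 u2 h2 m2 -> l1 0 = l2 0 -> u1 0 = u2 0 ->
  (forall p, 0 < p -> p < m1 -> p < m2 -> h1 p < h2 p) -> False.
Proof.
intros (M1 & Cl1 & Cu1 & El1 & Eu1 & L1 & U1 & D1) (M2 & Cl2 & Cu2 & El2 & Eu2 & L2 & U2 & D2) El Eu Hh.
set (m := Rmin m1 m2). assert (Hm : 0 < m) by (apply Rmin_pos; assumption).
pose proof (Rmin_l m1 m2) as Hm1. pose proof (Rmin_r m1 m2) as Hm2. fold m in Hm1, Hm2.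
assert (Hl : forall p, 0 < p < m -> l2 p < l1 p).
{ apply (branch_comparison l1 l2 (fun p => l1 p - h1 p) (fun p => l2 p - h2 p)); try assumption.
  - intros p Hp. destruct (Req_dec p 0) as [-> | ]; [split; assumption |].
    split; [apply D1 | apply D2]; lra.
  - intros p Hp. split; [apply D1 | apply D2]; lra.
  - intros p Hp _. specialize (Hh p). lra. }
assert (Hu : forall p, 0 < p < m -> u2 p < u1 p).
{ apply (branch_comparison u1 u2 (fun p => - u1 p - h1 p) (fun p => - u2 p - h2 p)); try assumption.
  - intros p Hp. destruct (Req_dec p 0) as [-> | ]; [split; assumption |].
    split; [apply D1 | apply D2]; lra.
  - intros p Hp. split; [apply D1 | apply D2]; lra.
  (* The difference of the derivatives exceeds [- (u1 p - u2 p)], which dominates [u1 p - u2 p] only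
     where [u1 p <= u2 p]; hence that premise in [branch_comparison]. *)
  - intros p Hp Hle. specialize (Hh p). lra. }
set (Q := fun (l u : R -> R) p => l p ^ 2 / 2 - u p ^ 2 / 2).
assert (CQ : forall l u, (forall p, continuous l p) -> (forall p, continuous u p) -> forall p, continuous (Q l u) p).
{ assert (Csq : forall f : R -> R, (forall p, continuous f p) -> forall p, continuous (fun q => f q ^ 2 / 2) p).
  { intros f Cf p. apply (continuous_comp f (fun z => z ^ 2 / 2)); [apply Cf |].
    apply @ex_derive_continuous. auto_derive; trivial. }
  intros l u Cl Cu p. apply (continuous_minus (fun q => l q ^ 2 / 2) (fun q => u q ^ 2 / 2)); apply Csq; assumption. }
assert (DQ1 : forall p, 0 < p < m1 -> is_derive (Q l1 u1) p ((l1 p - h1 p) - (- u1 p - h1 p))).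
{ intros p Hp. apply (is_derive_minus (fun q => l1 q ^ 2 / 2) (fun q => u1 q ^ 2 / 2)); apply D1; assumption. }
assert (DQ2 : forall p, 0 < p < m2 -> is_derive (Q l2 u2) p ((l2 p - h2 p) - (- u2 p - h2 p))).
{ intros p Hp. apply (is_derive_minus (fun q => l2 q ^ 2 / 2) (fun q => u2 q ^ 2 / 2)); apply D2; assumption. }
(* The larger lower branch cannot vanish first: at [m1 < m2] it would be [0] while [l2] is still
   positive. *)
destruct (Rlt_or_le m1 m2) as [Hlt | Hle].
- assert (Em : m = m1) by (apply Rmin_left; lra).
  destruct (D2 m1) as (Hl2 & _); [lra |].
  destruct (continuous_gt (fun p => l2 p - l1 p) m1 0) as (r & Hr & H).
  + apply (continuous_minus l2 l1); auto.
  + lra.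
  + set (q := Rmax (m1 / 2) (m1 - r / 2)).
    assert (q < m1) by (apply Rmax_lub_lt; lra).
    pose proof (Rmax_l (m1 / 2) (m1 - r / 2)). pose proof (Rmax_r (m1 / 2) (m1 - r / 2)). fold q in H1, H2.
    specialize (H q ltac:(apply Rabs_def1; lra)). specialize (Hl q ltac:(lra)). lra.
- assert (Em : m = m2) by (apply Rmin_right; lra).
  assert (Hq : Q l1 u1 0 - Q l2 u2 0 < Q l1 u1 m2 - Q l2 u2 m2).
  { apply (increasing_of_derive (fun p => Q l1 u1 p - Q l2 u2 p)
      (fun p => ((l1 p - h1 p) - (- u1 p - h1 p)) - ((l2 p - h2 p) - (- u2 p - h2 p))) 0 m2); try lra.
    - intros t _. apply (continuous_minus (Q l1 u1) (Q l2 u2)); apply CQ; assumption.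
    - intros t Ht. split.
      + apply (is_derive_minus (Q l1 u1) (Q l2 u2)); [apply DQ1 | apply DQ2]; lra.
      + specialize (Hl t ltac:(lra)). specialize (Hu t ltac:(lra)). lra. }
  assert (Hq0 : Q l1 u1 0 = Q l2 u2 0) by (unfold Q; rewrite El, Eu; reflexivity).
  assert (Hq2 : Q l2 u2 m2 = 0) by (unfold Q; rewrite El2, Eu2; ring).
  assert (Hq1 : Q l1 u1 m1 = 0) by (unfold Q; rewrite El1, Eu1; ring).
  (* Beyond [m2] only the first half orbit remains. Its [Q] still increases, with derivative
     [l1 + u1], up to [0] at [m1], so it was not positive at [m2]. *)
  assert (Q l1 u1 m2 <= Q l1 u1 m1); [| lra].
  destruct (Req_dec m1 m2) as [-> | Hne]; [lra |]. left.
  apply (increasing_of_derive (Q l1 u1) (fun p => (l1 p - h1 p) - (- u1 p - h1 p)) m2 m1); try lra.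
  + intros; apply CQ; assumption.
  + intros t Ht. split; [apply DQ1; lra |]. destruct (D1 t) as (? & ? & _); lra.
Qed.

(** * Crossing periodic orbits *)

Section Lienard.

Variables (Fp gp Fm gm : R -> R).
Hypotheses (Fp_C1 : C1 Fp) (Fm_C1 : C1 Fm) (gp_C1 : C1 gp) (gm_C1 : C1 gm).
Hypotheses (Fp0 : Fp 0 = 0) (Fm0 : Fm 0 = 0).
Variables (x y : R -> R) (T : R).
Hypothesis orbit : periodic_orbit Fp gp Fm gm x y T.

(* The function [p] of the paper, [F^+] on [[0, oo)] and [F^-] on [(-oo, 0]]. *)
Definition glue (z : R) : R := Fp (Rmax z 0) + Fm (Rmin z 0).

Definition speed (t : R) : R := glue (x t) - y t.

Lemma glue_pos z : 0 <= z -> glue z = Fp z.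
Proof.
intros H. unfold glue. rewrite Rmax_left, Rmin_right, Fm0 by lra. ring.
Qed.

Lemma glue_neg z : z <= 0 -> glue z = Fm z.
Proof.
intros H. unfold glue. rewrite Rmax_right, Rmin_left, Fp0 by lra. ring.
Qed.

Lemma glue_lipschitz_0 : exists K, 0 <= K /\ forall z, Rabs z <= 1 -> Rabs (glue z) <= K * Rabs z.
Proof.
destruct (C1_lipschitz Fp 1 Fp_C1) as (K1 & HK1 & L1).
destruct (C1_lipschitz Fm 1 Fm_C1) as (K2 & HK2 & L2).
exists (K1 + K2). split; [lra |]. intros z Hz.
assert (R0 : Rabs 0 <= 1) by (rewrite Rabs_R0; lra).
specialize (L1 z 0 Hz R0). specialize (L2 z 0 Hz R0).
rewrite Fp0, !Rminus_0_r in L1. rewrite Fm0, !Rminus_0_r in L2.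
pose proof (Rabs_pos z).
destruct (Rle_or_lt 0 z); [rewrite glue_pos by lra | rewrite glue_neg by lra]; nra.
Qed.

(** * Regularity of the orbit across the axis *)

Lemma x_continuous t : continuous x t.
Proof.
destruct orbit as [[Hac _] _]. apply ac_continuous. intros c d Hcd. apply Hac, Hcd.
Qed.

Lemma y_continuous t : continuous y t.
Proof.
destruct orbit as [[Hac _] _]. apply ac_continuous. intros c d Hcd. apply Hac, Hcd.
Qed.

Lemma glue_continuous z : continuous glue z.
Proof.
unfold glue. apply (continuous_plus (fun z => Fp (Rmax z 0)) (fun z => Fm (Rmin z 0))).
- apply (continuous_comp (fun z => Rmax z 0) Fp); [| apply C1_continuous, Fp_C1].
  apply continuous_eps. intros eps Heps. exists eps. split; [exact Heps |]. intros s Hs.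
  eapply Rle_lt_trans; [| exact Hs].
  unfold Rmax, Rabs. repeat destruct Rle_dec; repeat destruct Rcase_abs; lra.
- apply (continuous_comp (fun z => Rmin z 0) Fm); [| apply C1_continuous, Fm_C1].
  apply continuous_eps. intros eps Heps. exists eps. split; [exact Heps |]. intros s Hs.
  eapply Rle_lt_trans; [| exact Hs].
  unfold Rmin, Rabs. repeat destruct Rle_dec; repeat destruct Rcase_abs; lra.
Qed.

Lemma speed_continuous t : continuous speed t.
Proof.
apply (continuous_minus (fun t => glue (x t)) y); [| apply y_continuous].
apply (continuous_comp x glue); [apply x_continuous | apply glue_continuous].
Qed.

(** On the axis every velocity of the Filippov segment has the same first component [- y], because
    [Fp 0 = Fm 0 = 0]. So the almost everywhere derivative of [x] agrees with one continuous
    function. *)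
Lemma x_derive t : is_derive x t (speed t).
Proof.
destruct orbit as [[Hac Hae] _].
apply ac_derive.
- intros c d Hcd. apply Hac, Hcd.
- apply speed_continuous.
- exists 1. split; [lra |]. revert Hae. apply almost_everywhere_impl.
  intros s (u & w & Hu & _ & H1 & H2 & H3) _.
  cut (@eq R u (speed s)); [intros <-; exact Hu |]. unfold speed.
  destruct (Rtotal_order (x s) 0) as [H | [H | H]].
  + rewrite glue_neg by lra. apply H2, H.
  + destruct (H3 H) as (lam & _ & -> & _). rewrite H, glue_pos, Fp0, Fm0 by lra. ring.
  + rewrite glue_pos by lra. apply H1, H.
Qed.

Lemma y_derive_pos t : 0 < x t -> is_derive y t (gp (x t)).
Proof.
intros Ht. destruct orbit as [[Hac Hae] _].
apply (ac_derive y (fun s => gp (x s))).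
- intros c d Hcd. apply Hac, Hcd.
- apply (continuous_comp x gp); [apply x_continuous | apply C1_continuous, gp_C1].
- destruct (continuous_gt x t 0 (x_continuous t) Ht) as (r & Hr & Hpos).
  exists r. split; [exact Hr |]. revert Hae. apply almost_everywhere_impl.
  intros s (u & w & _ & Hw & H1 & _) Hs.
  destruct (H1 (Hpos s Hs)) as [_ <-]. exact Hw.
Qed.

Lemma y_derive_neg t : x t < 0 -> is_derive y t (gm (x t)).
Proof.
intros Ht. destruct orbit as [[Hac Hae] _].
apply (ac_derive y (fun s => gm (x s))).
- intros c d Hcd. apply Hac, Hcd.
- apply (continuous_comp x gm); [apply x_continuous | apply C1_continuous, gm_C1].
- destruct (continuous_lt x t 0 (x_continuous t) Ht) as (r & Hr & Hneg).
  exists r. split; [exact Hr |]. revert Hae. apply almost_everywhere_impl.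
  intros s (u & w & _ & Hw & _ & H1 & _) Hs.
  destruct (H1 (Hneg s Hs)) as [_ <-]. exact Hw.
Qed.

(** * Zeros of the velocity are simple *)

Lemma no_equilibrium t : ~ equilibrium Fp gp Fm gm (x t) (y t).
Proof.
apply orbit.
Qed.

Lemma origin_regular t : x t = 0 -> y t = 0 -> 0 < gp 0 * gm 0.
Proof.
intros Hx Hy. apply Rnot_le_lt. intros Hle. apply (no_equilibrium t).
rewrite Hx, Hy. split; [lra |]. split; [lra |]. intros _.
destruct (Req_dec (gp 0) (gm 0)) as [E | N].
- exists 0. split; [lra |]. rewrite Fp0, Fm0. split; [ring |]. nra.
(* The weight for which the convex combination of [gp 0] and [gm 0] vanishes; it lies in [[0, 1]]
   because their product is not positive. *)
- exists (gm 0 / (gm 0 - gp 0)). split; [| split].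
  + assert (Hq : forall a b, a * b <= 0 -> a <> b -> 0 <= b / (b - a)).
    { intros a b Hab Hne. replace (b / (b - a)) with (b * (b - a) * / (b - a) ^ 2) by (field; lra).
      apply Rmult_le_pos; [nra |]. left. apply Rinv_0_lt_compat.
      assert (b - a <> 0) by lra. pose proof (Rsqr_pos_lt _ H). rewrite Rsqr_pow2 in H0. exact H0. }
    split; [apply Hq; [exact Hle | exact N] |].
    pose proof (Hq (gm 0) (gp 0) ltac:(lra) ltac:(lra)).
    replace (gm 0 / (gm 0 - gp 0)) with (1 - gp 0 / (gp 0 - gm 0)) by (field; lra). lra.
  + rewrite Fp0, Fm0. ring.
  + field. lra.
Qed.

(* At a regular origin [y' ] has the sign of [gp 0] and is bounded away from [0],
   whereas [x = o(t)], so that [x' = p(x) - y] is dominated by [- y]. *)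
Lemma speed_sign_at_origin t : x t = 0 -> y t = 0 ->
  exists r, 0 < r /\ forall s, s <> t -> Rabs (s - t) < r -> gp 0 * (speed s * (s - t)) < 0.
Proof.
intros Hx Hy. pose proof (origin_regular t Hx Hy) as Hg.
(* [sg] is the common sign of [gp 0] and [gm 0]. Half the smaller modulus serves as [c], so that the
   bounds persist for nearby [x]. *)
assert (Hsgn : exists sg c, 0 < c /\ 0 < sg * gp 0 /\ (sg = 1 \/ sg = -1) /\ c < sg * gp 0 /\ c < sg * gm 0).
{ destruct (Rlt_or_le 0 (gp 0)).
  - assert (0 < gm 0) by nra. exists 1, (Rmin (gp 0) (gm 0) / 2).
    pose proof (Rmin_l (gp 0) (gm 0)). pose proof (Rmin_r (gp 0) (gm 0)).
    assert (0 < Rmin (gp 0) (gm 0)) by (apply Rmin_pos; assumption). repeat split; lra.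
  - assert (gp 0 < 0) by (destruct (Req_dec (gp 0) 0) as [E | ]; [rewrite E in Hg; lra | lra]).
    assert (gm 0 < 0) by nra. exists (-1), (Rmin (- gp 0) (- gm 0) / 2).
    pose proof (Rmin_l (- gp 0) (- gm 0)). pose proof (Rmin_r (- gp 0) (- gm 0)).
    assert (0 < Rmin (- gp 0) (- gm 0)) by (apply Rmin_pos; lra). repeat split; lra. }
destruct Hsgn as (sg & c & Hc & Hsg & Hsg1 & Hcp & Hcm).
assert (Cp : forall s, continuous (fun s => sg * gp (x s)) s).
{ intros s. apply (continuous_mult (fun _ => sg) (fun s => gp (x s))); [apply continuous_const |].
  apply (continuous_comp x gp); [apply x_continuous | apply C1_continuous, gp_C1]. }
assert (Cm : forall s, continuous (fun s => sg * gm (x s)) s).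
{ intros s. apply (continuous_mult (fun _ => sg) (fun s => gm (x s))); [apply continuous_const |].
  apply (continuous_comp x gm); [apply x_continuous | apply C1_continuous, gm_C1]. }
destruct (continuous_gt _ t c (Cp t)) as (r1 & Hr1 & H1); [rewrite Hx; exact Hcp |].
destruct (continuous_gt _ t c (Cm t)) as (r2 & Hr2 & H2); [rewrite Hx; exact Hcm |].
destruct glue_lipschitz_0 as (K & HK & HL).
assert (Hd : is_derive x t 0).
{ assert (E : speed t = 0) by (unfold speed; rewrite Hx, Hy, glue_pos, Fp0 by lra; ring).
  rewrite <- E. apply x_derive. }
apply is_derive_Reals in Hd.
(* The [1] keeps [x s] where the Lipschitz bound of [glue] holds. The quotient makes [glue (x s)]
   smaller than [c * Rabs (s - t)], and [K + 1] allows [K = 0]. *)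
assert (Heps : 0 < Rmin 1 (c / (K + 1))).
{ apply Rmin_pos; [lra | apply Rdiv_lt_0_compat; lra]. }
destruct (Hd _ Heps) as (r3 & Hr3).
set (r := Rmin (Rmin r1 r2) (Rmin r3 1)).
assert (Hr : 0 < r) by (repeat apply Rmin_pos; try lra; apply cond_pos).
exists r. split; [exact Hr |]. intros s Hne Hs.
assert (Hs1 : Rabs (s - t) < r1 /\ Rabs (s - t) < r2 /\ Rabs (s - t) < r3 /\ Rabs (s - t) < 1).
{ unfold r in Hs. pose proof (Rmin_l (Rmin r1 r2) (Rmin r3 1)). pose proof (Rmin_r (Rmin r1 r2) (Rmin r3 1)).
  pose proof (Rmin_l r1 r2). pose proof (Rmin_r r1 r2). pose proof (Rmin_l r3 1). pose proof (Rmin_r r3 1).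
  lra. }
destruct Hs1 as (Hs1 & Hs2 & Hs3 & Hs4).
assert (Hxs : Rabs (x s) <= Rmin 1 (c / (K + 1)) * Rabs (s - t)).
{ specialize (Hr3 (s - t) ltac:(lra) Hs3). replace (t + (s - t)) with s in Hr3 by ring.
  rewrite Hx, !Rminus_0_r in Hr3. unfold Rdiv in Hr3. rewrite Rabs_mult, Rabs_inv in Hr3.
  pose proof (Rabs_pos_lt (s - t) ltac:(lra)).
  apply Rmult_le_reg_r with (/ Rabs (s - t)); [apply Rinv_0_lt_compat; assumption |].
  rewrite (Rmult_assoc (Rmin _ _)), Rinv_r by lra. lra. }
assert (Hst : 0 < Rabs (s - t)) by (apply Rabs_pos_lt; lra).
pose proof (Rmin_l 1 (c / (K + 1))). pose proof (Rmin_r 1 (c / (K + 1))).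
assert (Hglue : Rabs (glue (x s)) < c * Rabs (s - t)).
{ apply Rle_lt_trans with (K * Rabs (x s)).
  - apply HL. nra.
  - apply Rle_lt_trans with (K * (c / (K + 1) * Rabs (s - t))).
    + apply Rmult_le_compat_l; [exact HK |]. eapply Rle_trans; [exact Hxs |].
      apply Rmult_le_compat_r; lra.
    + assert (Hk : K * (c / (K + 1)) < c).
      { apply Rmult_lt_reg_r with (K + 1); [lra |]. unfold Rdiv.
        replace (K * (c * / (K + 1)) * (K + 1)) with (K * c) by (field; lra). lra. }
      rewrite <- Rmult_assoc. apply Rmult_lt_compat_r; assumption. }
assert (Hae : forall a b, a <= b -> (forall q, a <= q <= b -> Rabs (q - t) <= Rabs (s - t)) ->
   c * (b - a) <= sg * y b - sg * y a).
{ intros a b Hab Hin. destruct orbit as [[Hac Haeq] _].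
  assert (Hboth : forall q, Rabs (q - t) <= Rabs (s - t) -> forall u w,
    filippov_field Fp gp Fm gm (x q) (y q) u w -> c <= sg * w).
  { intros q Hq u w (G1 & G2 & G3). specialize (H1 q ltac:(lra)). specialize (H2 q ltac:(lra)).
    cbv beta in H1, H2. destruct (Rtotal_order (x q) 0) as [E | [E | E]].
    - destruct (G2 E) as [_ ->]. lra.
    - destruct (G3 E) as (lam & Hlam & _ & ->). rewrite E in H1, H2.
      replace (sg * (lam * gp 0 + (1 - lam) * gm 0)) with (lam * (sg * gp 0) + (1 - lam) * (sg * gm 0)) by ring.
      nra.
    - destruct (G1 E) as [_ ->]. lra. }
  destruct Hsg1 as [-> | ->].
  - pose proof (ac_increment_ge y a b c Hab (proj2 (Hac a b Hab))) as G.
    rewrite !Rmult_1_l. apply G. revert Haeq. apply almost_everywhere_impl.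
    intros q (u & w & _ & Hw & Hf) Hq. exists w. split; [exact Hw |].
    specialize (Hboth q (Hin q Hq) u w Hf). lra.
  - pose proof (ac_increment_le y a b (- c) Hab (proj2 (Hac a b Hab))) as G.
    cut (y b - y a <= - c * (b - a)); [lra |].
    apply G. revert Haeq. apply almost_everywhere_impl.
    intros q (u & w & _ & Hw & Hf) Hq. exists w. split; [exact Hw |].
    specialize (Hboth q (Hin q Hq) u w Hf). lra. }
assert (Hys : c * (s - t) ^ 2 <= sg * y s * (s - t)).
{ destruct (Rlt_or_le t s) as [Hts | Hts].
  - specialize (Hae t s ltac:(lra)). rewrite Hy in Hae.
    assert (c * (s - t) <= sg * y s - sg * 0).
    { apply Hae. intros q Hq. rewrite !Rabs_pos_eq; lra. }
    nra.
  - specialize (Hae s t ltac:(lra)). rewrite Hy in Hae.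
    assert (c * (t - s) <= sg * 0 - sg * y s).
    { apply Hae. intros q Hq. rewrite !Rabs_left1; lra. }
    nra. }
assert (Hgs : sg * glue (x s) * (s - t) < c * (s - t) ^ 2).
{ apply Rle_lt_trans with (Rabs (glue (x s)) * Rabs (s - t)).
  - rewrite <- Rabs_mult. eapply Rle_trans; [apply Rle_abs |].
    rewrite !Rabs_mult. destruct Hsg1 as [-> | ->];
      [rewrite Rabs_R1 | rewrite Rabs_m1]; lra.
  - rewrite <- (pow2_abs (s - t)). nra. }
assert (Hfin : sg * (speed s * (s - t)) < 0).
{ unfold speed. lra. }
destruct Hsg1 as [-> | ->]; nra.
Qed.

Lemma speed_derive_pos (fp : R -> R) t :
  (forall z, is_derive Fp z (fp z)) -> 0 < x t ->
  is_derive speed t (fp (x t) * speed t - gp (x t)).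
Proof.
intros HF Ht.
apply is_derive_ext_loc with (fun s => Fp (x s) - y s).
- destruct (continuous_gt x t 0 (x_continuous t) Ht) as (r & Hr & Hpos).
  exists (mkposreal r Hr). intros s Hs. unfold speed. rewrite glue_pos; [reflexivity |].
  left. apply Hpos. exact Hs.
- apply (is_derive_minus (fun s => Fp (x s)) y); [| apply y_derive_pos, Ht].
  rewrite Rmult_comm. apply (is_derive_comp Fp x); [apply HF | apply x_derive].
Qed.

Lemma speed_derive_neg (fm : R -> R) t :
  (forall z, is_derive Fm z (fm z)) -> x t < 0 ->
  is_derive speed t (fm (x t) * speed t - gm (x t)).
Proof.
intros HF Ht.
apply is_derive_ext_loc with (fun s => Fm (x s) - y s).
- destruct (continuous_lt x t 0 (x_continuous t) Ht) as (r & Hr & Hneg).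
  exists (mkposreal r Hr). intros s Hs. unfold speed. rewrite glue_neg; [reflexivity |].
  left. apply Hneg. exact Hs.
- apply (is_derive_minus (fun s => Fm (x s)) y); [| apply y_derive_neg, Ht].
  rewrite Rmult_comm. apply (is_derive_comp Fm x); [apply HF | apply x_derive].
Qed.

Lemma gp_nonzero t : speed t = 0 -> 0 < x t -> gp (x t) <> 0.
Proof.
intros H0 Hx E. apply (no_equilibrium t). unfold speed in H0. rewrite glue_pos in H0 by lra.
split; [intros _; split; lra |]. split; intros; lra.
Qed.

Lemma gm_nonzero t : speed t = 0 -> x t < 0 -> gm (x t) <> 0.
Proof.
intros H0 Hx E. apply (no_equilibrium t). unfold speed in H0. rewrite glue_neg in H0 by lra.
split; [intros; lra |]. split; [intros _; split; lra | intros; lra].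
Qed.

(** At a zero off the axis the derivative of [speed] is [- g], which is nonzero since the point is
    not an equilibrium. A zero on the axis is the origin, where the sign is known directly. *)
Lemma speed_simple_zeros t : speed t = 0 -> exists r, 0 < r /\
  ((forall s, s <> t -> Rabs (s - t) < r -> 0 < speed s * (s - t)) \/
   (forall s, s <> t -> Rabs (s - t) < r -> speed s * (s - t) < 0)).
Proof.
intros H0.
assert (Hgen : forall d, d <> 0 -> (exists r, 0 < r /\ forall s, s <> t -> Rabs (s - t) < r ->
   0 < d * (speed s * (s - t))) -> exists r, 0 < r /\
  ((forall s, s <> t -> Rabs (s - t) < r -> 0 < speed s * (s - t)) \/
   (forall s, s <> t -> Rabs (s - t) < r -> speed s * (s - t) < 0))).
{ intros d Hd (r & Hr & H). exists r. split; [exact Hr |].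
  destruct (Rlt_or_le 0 d); [left | right]; intros s Hs Hsr; specialize (H s Hs Hsr); nra. }
destruct (Rtotal_order (x t) 0) as [Hx | [Hx | Hx]].
- destruct Fm_C1 as (fm & HF & _). pose proof (speed_derive_neg fm t HF Hx) as Hd.
  pose proof (gm_nonzero t H0 Hx). rewrite H0 in Hd.
  apply (Hgen (fm (x t) * 0 - gm (x t))); [lra |].
  apply sign_change_of_derive; [exact Hd | exact H0 | lra].
- assert (Hy : y t = 0).
  { unfold speed in H0. rewrite Hx, glue_pos, Fp0 in H0 by lra. lra. }
  pose proof (origin_regular t Hx Hy) as Hg.
  apply (Hgen (- gp 0)); [intros E; replace (gp 0) with 0 in Hg by lra; lra |].
  destruct (speed_sign_at_origin t Hx Hy) as (r & Hr & H). exists r. split; [exact Hr |].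
  intros s Hs Hsr. specialize (H s Hs Hsr). lra.
- destruct Fp_C1 as (fp & HF & _). pose proof (speed_derive_pos fp t HF Hx) as Hd.
  pose proof (gp_nonzero t H0 Hx). rewrite H0 in Hd.
  apply (Hgen (fp (x t) * 0 - gp (x t))); [lra |].
  apply sign_change_of_derive; [exact Hd | exact H0 | lra].
Qed.

(** * Forward uniqueness and injectivity of the state *)

Definition enters_right (a b : R) : Prop :=
  0 < a \/ (a = 0 /\ (b < 0 \/ (b = 0 /\ gp 0 < 0))).

(** On the axis [x' = - y] decides. At the origin [gp 0 < 0] makes [y] decrease on either side, so
    [x'] becomes positive. *)
Lemma moves_right t : enters_right (x t) (y t) ->
  exists r, 0 < r /\ forall s, t < s < t + r -> 0 < x s.
Proof.
intros [Hx | [Hx Hy]].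
- destruct (continuous_gt x t 0 (x_continuous t) Hx) as (r & Hr & H).
  exists r. split; [exact Hr |]. intros s Hs. apply H. apply Rabs_def1; lra.
- assert (Hv : exists r, 0 < r /\ forall s, t < s < t + r -> 0 < speed s).
  { destruct Hy as [Hy | [Hy Hg]].
    - destruct (continuous_gt speed t 0 (speed_continuous t)) as (r & Hr & H).
      + unfold speed. rewrite Hx, glue_pos, Fp0 by lra. lra.
      + exists r. split; [exact Hr |]. intros s Hs. apply H. apply Rabs_def1; lra.
    - destruct (speed_sign_at_origin t Hx Hy) as (r & Hr & H).
      exists r. split; [exact Hr |]. intros s Hs.
      specialize (H s ltac:(lra) ltac:(apply Rabs_def1; lra)).
      assert (gp 0 * (s - t) < 0) by nra. nra. }
  destruct Hv as (r & Hr & H). exists r. split; [exact Hr |]. intros s Hs. rewrite <- Hx.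
  apply (increasing_of_derive x speed t s); try lra; intros.
  + apply x_continuous.
  + split; [apply x_derive | apply H; lra].
Qed.

Lemma moves_left t : ~ enters_right (x t) (y t) ->
  exists r, 0 < r /\ forall s, t < s < t + r -> x s < 0.
Proof.
intros Hn. unfold enters_right in Hn.
destruct (Rtotal_order (x t) 0) as [Hx | [Hx | Hx]]; [| | exfalso; apply Hn; left; exact Hx].
- destruct (continuous_lt x t 0 (x_continuous t) Hx) as (r & Hr & H).
  exists r. split; [exact Hr |]. intros s Hs. apply H. apply Rabs_def1; lra.
- assert (Hv : exists r, 0 < r /\ forall s, t < s < t + r -> speed s < 0).
  { destruct (Req_dec (y t) 0) as [Hy | Hy].
    - pose proof (origin_regular t Hx Hy).
      assert (0 < gp 0).
      { destruct (Rtotal_order (gp 0) 0) as [E | [E | E]];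
          [exfalso; apply Hn; right; split; [exact Hx | right; split; assumption] | rewrite E in H; lra | exact E]. }
      destruct (speed_sign_at_origin t Hx Hy) as (r & Hr & Hs0).
      exists r. split; [exact Hr |]. intros s Hs.
      specialize (Hs0 s ltac:(lra) ltac:(apply Rabs_def1; lra)).
      assert (0 < gp 0 * (s - t)) by nra. nra.
    - destruct (continuous_lt speed t 0 (speed_continuous t)) as (r & Hr & H).
      + unfold speed. rewrite Hx, glue_pos, Fp0 by lra.
        assert (~ y t < 0); [| lra]. intros Hlt. apply Hn. right. split; [exact Hx | left; exact Hlt].
      + exists r. split; [exact Hr |]. intros s Hs. apply H. apply Rabs_def1; lra. }
  destruct Hv as (r & Hr & H). exists r. split; [exact Hr |]. intros s Hs. rewrite <- Hx.
  apply (decreasing_of_derive x speed t s); try lra; intros.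
  + apply x_continuous.
  + split; [apply x_derive | apply H; lra].
Qed.

(** The side entered depends on the state alone, so both continuations solve the same smooth system
    for a short time. *)
Lemma local_forward_unique s t : x s = x t -> y s = y t ->
  exists r, 0 < r /\ forall q, 0 <= q < r -> x (s + q) = x (t + q) /\ y (s + q) = y (t + q).
Proof.
intros Ex Ey.
destruct (classic (enters_right (x t) (y t))) as [Hr | Hl].
- destruct (moves_right t Hr) as (r1 & Hr1 & H1).
  destruct (moves_right s) as (r2 & Hr2 & H2); [rewrite Ex, Ey; exact Hr |].
  exists (Rmin r1 r2). split; [apply Rmin_pos; assumption |]. intros q Hq.
  pose proof (Rmin_l r1 r2). pose proof (Rmin_r r1 r2).
  assert (Hd : forall a r, r = Rmin r1 r2 -> (forall u, a < u < a + r -> 0 < x u) -> forall u, 0 < u < r ->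
     is_derive (fun u => x (a + u)) u (Fp (x (a + u)) - y (a + u)) /\
     is_derive (fun u => y (a + u)) u (gp (x (a + u)))).
  { intros a r Er Hpos u Hu. specialize (Hpos (a + u) ltac:(lra)). split.
    - apply (shift_derive x). replace (Fp (x (a + u)) - y (a + u)) with (speed (a + u)); [apply x_derive |].
      unfold speed. rewrite glue_pos by lra. reflexivity.
    - apply (shift_derive y), y_derive_pos, Hpos. }
  apply (lienard_forward_unique Fp gp (fun u => x (s + u)) (fun u => y (s + u))
           (fun u => x (t + u)) (fun u => y (t + u)) (Rmin r1 r2)); auto using shift_continuous, x_continuous, y_continuous.
  + apply Rmin_pos; assumption.
  + apply Hd; [reflexivity |]. intros u Hu. apply H2. lra.
  + apply Hd; [reflexivity |]. intros u Hu. apply H1. lra.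
  + rewrite !Rplus_0_r. exact Ex.
  + rewrite !Rplus_0_r. exact Ey.
  + lra.
- destruct (moves_left t Hl) as (r1 & Hr1 & H1).
  destruct (moves_left s) as (r2 & Hr2 & H2); [rewrite Ex, Ey; exact Hl |].
  exists (Rmin r1 r2). split; [apply Rmin_pos; assumption |]. intros q Hq.
  pose proof (Rmin_l r1 r2). pose proof (Rmin_r r1 r2).
  assert (Hd : forall a r, r = Rmin r1 r2 -> (forall u, a < u < a + r -> x u < 0) -> forall u, 0 < u < r ->
     is_derive (fun u => x (a + u)) u (Fm (x (a + u)) - y (a + u)) /\
     is_derive (fun u => y (a + u)) u (gm (x (a + u)))).
  { intros a r Er Hneg u Hu. specialize (Hneg (a + u) ltac:(lra)). split.
    - apply (shift_derive x). replace (Fm (x (a + u)) - y (a + u)) with (speed (a + u)); [apply x_derive |].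
      unfold speed. rewrite glue_neg by lra. reflexivity.
    - apply (shift_derive y), y_derive_neg, Hneg. }
  apply (lienard_forward_unique Fm gm (fun u => x (s + u)) (fun u => y (s + u))
           (fun u => x (t + u)) (fun u => y (t + u)) (Rmin r1 r2)); auto using shift_continuous, x_continuous, y_continuous.
  + apply Rmin_pos; assumption.
  + apply Hd; [reflexivity |]. intros u Hu. apply H2. lra.
  + apply Hd; [reflexivity |]. intros u Hu. apply H1. lra.
  + rewrite !Rplus_0_r. exact Ex.
  + rewrite !Rplus_0_r. exact Ey.
  + lra.
Qed.

Lemma forward_unique s t : x s = x t -> y s = y t ->
  forall q, 0 <= q -> x (s + q) = x (t + q) /\ y (s + q) = y (t + q).
Proof.
intros Ex Ey q Hq.
assert (HP : forall u, 0 <= u <= q -> x (s + u) = x (t + u) /\ y (s + u) = y (t + u)).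
{ apply (interval_induction
    (fun e => forall u, 0 <= u <= e -> x (s + u) = x (t + u) /\ y (s + u) = y (t + u)) 0).
  - exact Hq.
  - intros u Hu. replace u with 0 by lra. rewrite !Rplus_0_r. split; assumption.
  - intros z Hz.
    (* Agreement before [z] extends to [z] by continuity and beyond it by local uniqueness. If it
       fails at some [u < z], agreement up to a point between [u] and [z] is absurd, and the radius
       [z - u] leaves only such points. *)
    destruct (classic (forall u, 0 <= u < z -> x (s + u) = x (t + u) /\ y (s + u) = y (t + u))) as [Hall | Hnot].
    + assert (Ez : x (s + z) = x (t + z) /\ y (s + z) = y (t + z)).
      { destruct (Req_dec z 0) as [-> | Hz0]; [rewrite !Rplus_0_r; split; assumption |].
        split.
        - apply (continuous_eq_left (fun u => x (s + u)) (fun u => x (t + u)) z 0);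
            auto using shift_continuous, x_continuous; [lra |]. intros u Hu. apply Hall. lra.
        - apply (continuous_eq_left (fun u => y (s + u)) (fun u => y (t + u)) z 0);
            auto using shift_continuous, y_continuous; [lra |]. intros u Hu. apply Hall. lra. }
      destruct (local_forward_unique (s + z) (t + z) (proj1 Ez) (proj2 Ez)) as (r & Hr & H).
      exists r. split; [exact Hr |]. intros e e' _ _ He He' _ u Hu.
      destruct (Rlt_or_le u z) as [Huz | Huz]; [apply Hall; lra |].
      specialize (H (u - z) ltac:(lra)).
      replace (s + z + (u - z)) with (s + u) in H by ring.
      replace (t + z + (u - z)) with (t + u) in H by ring. exact H.
    + apply not_all_ex_not in Hnot. destruct Hnot as (u & Hu). apply imply_to_and in Hu.
      destruct Hu as [Hu Hneq]. exists (z - u). split; [lra |].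
      intros e e' _ _ He He' Hind. exfalso. apply Hneq, Hind. lra. }
apply HP. lra.
Qed.

Lemma x_periodic t : x (t + T) = x t.
Proof. apply orbit. Qed.

Lemma y_periodic t : y (t + T) = y t.
Proof. apply orbit. Qed.

Lemma T_positive : 0 < T.
Proof. apply orbit. Qed.

Lemma speed_periodic t : speed (t + T) = speed t.
Proof. unfold speed. rewrite x_periodic, y_periodic. reflexivity. Qed.

(** [speed] and [x] determine [y], so a repeated state would make [t - s] a period smaller than
    [T]. *)
Lemma state_injective s t : s < t < s + T -> x s = x t -> speed s = speed t -> False.
Proof.
intros Hst Ex Ev.
assert (Ey : y s = y t) by (unfold speed in Ev; rewrite Ex in Ev; lra).
pose proof T_positive as HT. assert (Hmin : forall s, 0 < s < T -> ~ (forall t, x (t + s) = x t /\ y (t + s) = y t)) by apply orbit.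
apply (Hmin (t - s)); [lra |]. intros q.
(* Adding periods moves an arbitrary time [q] past [s], where forward uniqueness applies. *)
destruct (INR_unbounded ((s - q) / T)) as [n Hn].
assert (Hq : 0 <= q + INR n * T - s).
{ apply Rmult_lt_compat_r with (r := T) in Hn; [| exact HT].
  unfold Rdiv in Hn. rewrite Rmult_assoc, Rinv_l, Rmult_1_r in Hn by lra. lra. }
destruct (forward_unique s t Ex Ey _ Hq) as [E1 E2].
replace (s + (q + INR n * T - s)) with (q + INR n * T) in E1, E2 by ring.
replace (t + (q + INR n * T - s)) with (q + (t - s) + INR n * T) in E1, E2 by ring.
rewrite INR_IZR_INZ, !(periodic_IZR x T x_periodic) in E1.
rewrite INR_IZR_INZ, !(periodic_IZR y T y_periodic) in E2. split; congruence.
Qed.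

Lemma orbit_shape : exists t1 t2, t1 < t2 < t1 + T /\ speed t1 = 0 /\ speed t2 = 0 /\
  (forall t, t1 < t < t2 -> speed t < 0) /\ (forall t, t2 < t < t1 + T -> 0 < speed t).
Proof.
pose proof T_positive as HT.
destruct (continuity_ab_maj x 0 T) as (t1 & Hmax & _); [lra | |].
{ intros t _. apply continuity_pt_filterlim, x_continuous. }
destruct (periodic_unimodal x speed T x_derive speed_continuous HT x_periodic speed_periodic
            state_injective speed_simple_zeros t1) as (V1 & t2 & H12 & V2 & Hneg & Hpos).
- intros t. destruct (period_reduce T 0 t HT) as (k & Hk).
  rewrite <- (periodic_IZR x T x_periodic k t). apply Hmax. lra.
- exists t1, t2. repeat split; try assumption; lra.
Qed.

(** * The two monotone arcs of one period *)

Section Shape.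

Variables t1 t2 : R.
Hypothesis t12 : t1 < t2 < t1 + T.
Hypotheses (speed_t1 : speed t1 = 0) (speed_t2 : speed t2 = 0).
Hypothesis leftward : forall t, t1 < t < t2 -> speed t < 0.
Hypothesis rightward : forall t, t2 < t < t1 + T -> 0 < speed t.

Lemma x_decreasing s t : t1 <= s -> s < t -> t <= t2 -> x t < x s.
Proof.
apply (decreasing_of_derive x speed).
- intros; apply x_continuous.
- intros u Hu. split; [apply x_derive | apply leftward, Hu].
Qed.

Lemma x_increasing s t : t2 <= s -> s < t -> t <= t1 + T -> x s < x t.
Proof.
apply (increasing_of_derive x speed).
- intros; apply x_continuous.
- intros u Hu. split; [apply x_derive | apply rightward, Hu].
Qed.

Lemma x_range t : x t2 <= x t <= x t1.
Proof.
destruct (period_reduce T t1 t T_positive) as (k & Hk).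
rewrite <- (periodic_IZR x T x_periodic k t). set (q := t + IZR k * T) in *.
destruct (Rle_or_lt q t2) as [H | H].
- split.
  + destruct (Req_dec q t2) as [-> | ]; [lra |]. left. apply x_decreasing; lra.
  + destruct (Req_dec q t1) as [-> | ]; [lra |]. left. apply x_decreasing; lra.
- split; left.
  + apply x_increasing; lra.
  + rewrite <- (x_periodic t1). apply x_increasing; lra.
Qed.

Lemma crossing_times c : x t2 < c < x t1 ->
  exists s0 s1, t1 < s0 < t2 /\ t2 < s1 < t1 + T /\ x s0 = c /\ x s1 = c.
Proof.
intros Hc.
destruct (intermediate_value x t1 t2 c) as (s0 & Hs0 & E0).
- lra.
- apply x_continuous.
- rewrite Rmin_right, Rmax_left; lra.
- destruct (intermediate_value x t2 (t1 + T) c) as (s1 & Hs1 & E1).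
  + lra.
  + apply x_continuous.
  + rewrite x_periodic, Rmin_left, Rmax_right; lra.
  + exists s0, s1. assert (s0 <> t1 /\ s0 <> t2 /\ s1 <> t2 /\ s1 <> t1 + T).
    { repeat split; intros ->; try rewrite x_periodic in E1; lra. }
    repeat split; lra.
Qed.

Lemma critical_values t : speed t = 0 -> x t = x t1 \/ x t = x t2.
Proof.
destruct (period_reduce T t1 t T_positive) as (k & Hk).
rewrite <- (periodic_IZR x T x_periodic k t), <- (periodic_IZR speed T speed_periodic k t).
set (q := t + IZR k * T) in *. intros Hq.
destruct (Req_dec q t1) as [-> | N1]; [left; reflexivity |].
destruct (Req_dec q t2) as [-> | N2]; [right; reflexivity | exfalso].
destruct (Rlt_or_le q t2).
- specialize (leftward q). lra.
- specialize (rightward q). lra.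
Qed.

Lemma transversal_between c : x t2 < c < x t1 -> transversally_intersects_vertical x c.
Proof.
intros Hc. split.
- destruct (crossing_times c Hc) as (s0 & _ & _ & _ & E & _). exists s0. exact E.
- intros t Ht. exists (speed t). split; [apply x_derive |].
  intros H. destruct (critical_values t H); lra.
Qed.

(** The centre lies on the curve [y = p(x)], where [x' = 0]. The leftward crossing of the vertical
    line through it is therefore above the centre and the rightward one below; [O] and [E] are both
    on that curve. *)
Lemma surrounds_between c : x t2 < c < x t1 -> surrounds_counterclockwise x y T (c, glue c).
Proof.
intros Hc. destruct (crossing_times c Hc) as (s0 & s1 & Hs0 & Hs1 & E0 & E1).
assert (Es : x (s1 - T) = c /\ y (s1 - T) = y s1).
{ rewrite <- (x_periodic (s1 - T)), <- (y_periodic (s1 - T)).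
  replace (s1 - T + T) with s1 by ring. split; [exact E1 | reflexivity]. }
destruct Es as [Ex Ey].
(* The period starts at the rightward crossing preceding the maximum, so that its first part is the
   one on the right. *)
apply (winds_once x y T c (glue c) (s1 - T) s0).
- apply x_continuous.
- apply y_continuous.
- apply x_periodic.
- apply y_periodic.
- lra.
- intros t Ht Hy. assert (Hv : speed t = 0) by (unfold speed; rewrite Ht; lra).
  destruct (critical_values t Hv); lra.
- exact Ex.
- rewrite Ey. pose proof (rightward s1 Hs1) as H. unfold speed in H. rewrite E1 in H. lra.
- exact E0.
- pose proof (leftward s0 Hs0) as H. unfold speed in H. rewrite E0 in H. lra.
- intros t Ht. destruct (Rle_or_lt t1 t).
  + destruct (Req_dec t s0) as [-> | ]; [lra |]. rewrite <- E0. left. apply x_decreasing; lra.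
  + rewrite <- (x_periodic t), <- E1.
    destruct (Req_dec (t + T) s1) as [-> | ]; [lra |]. left. apply x_increasing; lra.
- intros t Ht. destruct (Rle_or_lt t t2).
  + destruct (Req_dec t s0) as [-> | ]; [lra |]. rewrite <- E0. left. apply x_decreasing; lra.
  + destruct (Req_dec t s1) as [-> | ]; [lra |]. rewrite <- E1. left. apply x_increasing; lra.
Qed.

(** At the maximum the derivative of [speed] is [- gp (x t1)]. It is nonzero, and a positive value
    would contradict the leftward motion just after [t1]. *)
Lemma gp_pos_at_max : 0 < x t1 -> 0 < gp (x t1).
Proof.
intros Hx. pose proof (gp_nonzero t1 speed_t1 Hx) as Hne.
apply Rnot_le_lt. intros Hle.
destruct Fp_C1 as (fp & HF & _). pose proof (speed_derive_pos fp t1 HF Hx) as Hd.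
rewrite speed_t1 in Hd.
destruct (sign_change_of_derive speed t1 _ Hd speed_t1) as (r & Hr & H); [lra |].
set (q := Rmin (t1 + r / 2) ((t1 + t2) / 2)).
assert (t1 < q) by (apply Rmin_glb_lt; lra).
pose proof (Rmin_l (t1 + r / 2) ((t1 + t2) / 2)). pose proof (Rmin_r (t1 + r / 2) ((t1 + t2) / 2)).
fold q in H1, H2.
specialize (H q ltac:(lra) ltac:(apply Rabs_def1; lra)). specialize (leftward q ltac:(lra)).
assert (speed q * (q - t1) < 0) by nra. nra.
Qed.

(** * The half orbits on the two sides of the axis *)

Variables s0 s1 : R.
Hypotheses (s0_between : t1 < s0 < t2) (s1_between : t2 < s1 < t1 + T).
Hypotheses (x_s0 : x s0 = 0) (x_s1 : x s1 = 0).

Lemma opp_speed_continuous t : continuous (fun t => - speed t) t.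
Proof. apply (continuous_opp speed t), speed_continuous. Qed.

Lemma F_along_continuous F : C1 F -> forall t, continuous (fun t => F (x t)) t.
Proof.
intros HF t. apply (continuous_comp x F); [apply x_continuous | apply C1_continuous, HF].
Qed.

Lemma F_along_derive (F f : R -> R) t : (forall z, is_derive F z (f z)) ->
  is_derive (fun t => F (x t)) t (f (x t) * speed t).
Proof.
intros HF. rewrite Rmult_comm. apply (is_derive_comp F x); [apply HF | apply x_derive].
Qed.

Lemma opp_derive (w : R -> R) t d : is_derive w t d -> is_derive (fun t => - w t) t (- d).
Proof. apply (is_derive_opp w t d). Qed.

(** The lower branch is the rightward arc over [[s1, t1 + T]], the upper one the leftward arc over
    [[t1, s0]]. Their values at [p = 0] are velocities on the axis, which the left half orbit shares
    because [speed] is continuous there. *)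
Lemma right_half_orbit (fp h : R -> R) :
  (forall z, is_derive Fp z (fp z)) -> (forall z, 0 < z -> 0 < fp z) ->
  (forall z, 0 < z -> h (Fp z) = gp z / fp z) ->
  exists l u, half_orbit l u h (Fp (x t1)) /\ l 0 = speed s1 /\ u 0 = - speed s0.
Proof.
intros HF Hf Hh.
assert (Hx0 : forall t, t1 < t < s0 -> 0 < x t).
{ intros t Ht. rewrite <- x_s0. apply x_decreasing; lra. }
assert (Hx1 : forall t, s1 < t < t1 + T -> 0 < x t).
{ intros t Ht. rewrite <- x_s1. apply x_increasing; lra. }
destruct (branch_increasing (fun t => Fp (x t)) (fun t => fp (x t) * speed t) speed
  (fun t => fp (x t) * speed t - gp (x t)) s1 (t1 + T)) as (l & L1 & L2 & L3 & L4).
- lra.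
- apply F_along_continuous, Fp_C1.
- apply speed_continuous.
- intros t Ht. split; [apply F_along_derive, HF |].
  apply Rmult_lt_0_compat; [apply Hf, Hx1, Ht | apply rightward; lra].
- intros t Ht. apply speed_derive_pos; [exact HF | apply Hx1, Ht].
- destruct (branch_decreasing (fun t => Fp (x t)) (fun t => fp (x t) * speed t) (fun t => - speed t)
    (fun t => - (fp (x t) * speed t - gp (x t))) t1 s0) as (u & U1 & U2 & U3 & U4).
  + lra.
  + apply F_along_continuous, Fp_C1.
  + apply opp_speed_continuous.
  + intros t Ht. split; [apply F_along_derive, HF |].
    specialize (Hf _ (Hx0 t Ht)). specialize (leftward t ltac:(lra)). nra.
  + intros t Ht. apply opp_derive, speed_derive_pos; [exact HF | apply Hx0, Ht].
  + cbv beta in *. rewrite x_s1, Fp0 in L2, L4. rewrite x_s0, Fp0 in U3, U4.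
    rewrite x_periodic in L3, L4. rewrite speed_periodic, speed_t1 in L3. rewrite speed_t1 in U2.
    exists l, u. split; [| split; assumption]. split.
    * rewrite <- Fp0. apply (increasing_of_derive Fp fp 0 (x t1)); try lra.
      -- intros; apply C1_continuous, Fp_C1.
      -- intros z Hz. split; [apply HF | apply Hf; lra].
      -- rewrite <- x_s0. apply x_decreasing; lra.
    * split; [exact L1 |]. split; [exact U1 |]. split; [exact L3 |]. split; [lra |].
      split; [rewrite L2; apply rightward; lra |].
      split; [rewrite U3; specialize (leftward s0); lra |].
      intros p Hp.
      destruct (L4 p Hp) as (t & Ht & Pt & Lt & Dl).
      destruct (U4 p Hp) as (t' & Ht' & Pt' & Ut & Du).
      pose proof (rightward t ltac:(lra)) as Vt. pose proof (leftward t' ltac:(lra)) as Vt'.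
      pose proof (Hf _ (Hx1 t Ht)). pose proof (Hf _ (Hx0 t' Ht')).
      split; [lra |]. split; [lra |]. split.
      (* With [v] for the velocity, [v * (f v - g) / (f v) = v - g / f]. *)
      -- replace (l p - h p) with (speed t * ((fp (x t) * speed t - gp (x t)) / (fp (x t) * speed t))); [exact Dl |].
         rewrite Lt, <- Pt, Hh by (apply Hx1, Ht). field. lra.
      -- replace (- u p - h p) with (- speed t' * (- (fp (x t') * speed t' - gp (x t')) / (fp (x t') * speed t')));
           [exact Du |].
         rewrite Ut, <- Pt', Hh by (apply Hx0, Ht'). field. lra.
Qed.

(** [Fm] decreases on the left, so the two arcs exchange roles: [p] now falls along the rightward
    arc over [[t2, s1]] and grows along the leftward arc over [[s0, t2]]. *)
Lemma left_half_orbit (fm h : R -> R) :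
  (forall z, is_derive Fm z (fm z)) -> (forall z, z < 0 -> fm z < 0) ->
  (forall z, z < 0 -> h (Fm z) = gm z / fm z) ->
  exists l u, half_orbit l u h (Fm (x t2)) /\ l 0 = speed s1 /\ u 0 = - speed s0.
Proof.
intros HF Hf Hh.
assert (Hx0 : forall t, s0 < t < t2 -> x t < 0).
{ intros t Ht. rewrite <- x_s0. apply x_decreasing; lra. }
assert (Hx1 : forall t, t2 < t < s1 -> x t < 0).
{ intros t Ht. rewrite <- x_s1. apply x_increasing; lra. }
destruct (branch_decreasing (fun t => Fm (x t)) (fun t => fm (x t) * speed t) speed
  (fun t => fm (x t) * speed t - gm (x t)) t2 s1) as (l & L1 & L2 & L3 & L4).
- lra.
- apply F_along_continuous, Fm_C1.
- apply speed_continuous.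
- intros t Ht. split; [apply F_along_derive, HF |].
  specialize (Hf _ (Hx1 t Ht)). specialize (rightward t ltac:(lra)). nra.
- intros t Ht. apply speed_derive_neg; [exact HF | apply Hx1, Ht].
- destruct (branch_increasing (fun t => Fm (x t)) (fun t => fm (x t) * speed t) (fun t => - speed t)
    (fun t => - (fm (x t) * speed t - gm (x t))) s0 t2) as (u & U1 & U2 & U3 & U4).
  + lra.
  + apply F_along_continuous, Fm_C1.
  + apply opp_speed_continuous.
  + intros t Ht. split; [apply F_along_derive, HF |].
    specialize (Hf _ (Hx0 t Ht)). specialize (leftward t ltac:(lra)). nra.
  + intros t Ht. apply opp_derive, speed_derive_neg; [exact HF | apply Hx0, Ht].
  + cbv beta in *. rewrite x_s1, Fm0 in L3, L4. rewrite x_s0, Fm0 in U2, U4.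
    rewrite speed_t2 in L2, U3.
    exists l, u. split; [| split; assumption]. split.
    * rewrite <- Fm0. apply (decreasing_of_derive Fm fm (x t2) 0); try lra.
      -- intros; apply C1_continuous, Fm_C1.
      -- intros z Hz. split; [apply HF | apply Hf; lra].
      -- rewrite <- x_s0. apply x_decreasing; lra.
    * split; [exact L1 |]. split; [exact U1 |]. split; [exact L2 |]. split; [lra |].
      split; [rewrite L3; apply rightward; lra |].
      split; [rewrite U2; specialize (leftward s0); lra |].
      intros p Hp.
      destruct (L4 p Hp) as (t & Ht & Pt & Lt & Dl).
      destruct (U4 p Hp) as (t' & Ht' & Pt' & Ut & Du).
      pose proof (rightward t ltac:(lra)) as Vt. pose proof (leftward t' ltac:(lra)) as Vt'.
      pose proof (Hf _ (Hx1 t Ht)). pose proof (Hf _ (Hx0 t' Ht')).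
      split; [lra |]. split; [lra |]. split.
      -- replace (l p - h p) with (speed t * ((fm (x t) * speed t - gm (x t)) / (fm (x t) * speed t))); [exact Dl |].
         rewrite Lt, <- Pt, Hh by (apply Hx1, Ht). field. lra.
      -- replace (- u p - h p) with (- speed t' * (- (fm (x t') * speed t' - gm (x t')) / (fm (x t') * speed t')));
           [exact Du |].
         rewrite Ut, <- Pt', Hh by (apply Hx0, Ht'). field. lra.
Qed.

End Shape.

End Lienard.

(** * The common values of [h^+] and [h^-] *)

Lemma smooth_C1 (f : R -> R) : smooth f -> C1 f.
Proof.
intros Hf. exists (Derive f). split; intros t.
- apply Derive_correct. exact (Hf 1%nat t).
- apply @ex_derive_continuous. exact (Hf 2%nat t).
Qed.

Lemma int_from_0_derive (f : R -> R) : (forall t, continuous f t) -> forall x, is_derive (int_from_0 f) x (f x).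
Proof.
intros Hf x. apply (is_derive_RInt f (int_from_0 f) 0 x); [| apply Hf].
apply filter_forall. intros z. apply (RInt_correct f 0 z). apply (ex_RInt_continuous f). intros; apply Hf.
Qed.

Lemma int_from_0_0 f : int_from_0 f 0 = 0.
Proof. apply (RInt_point 0 f). Qed.

Lemma at_right_ex (P : R -> Prop) : at_right 0 P -> exists r, 0 < r /\ forall p, 0 < p < r -> P p.
Proof.
intros (r & Hr). exists r. split; [apply cond_pos |]. intros p Hp. apply Hr; [| lra].
change (Rabs (p - 0) < r). rewrite Rabs_pos_eq; lra.
Qed.

Lemma ordered_near_0 (h1 h2 : R -> R) (e1 e2 : R) :
  filterlim h1 (at_right 0) (locally e1) -> filterlim h2 (at_right 0) (locally e2) ->
  e1 <= e2 -> (e1 = e2 -> at_right 0 (fun p => h1 p < h2 p)) ->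
  exists r, 0 < r /\ forall p, 0 < p < r -> h1 p < h2 p.
Proof.
intros L1 L2 Hle Heq. destruct (Req_dec e1 e2) as [E | N]; [apply at_right_ex, Heq, E |].
assert (He : 0 < (e2 - e1) / 2) by lra.
destruct (at_right_ex (fun p => Rabs (h1 p - e1) < (e2 - e1) / 2)) as (r1 & Hr1 & A1).
{ exact (L1 _ (locally_ball e1 (mkposreal _ He))). }
destruct (at_right_ex (fun p => Rabs (h2 p - e2) < (e2 - e1) / 2)) as (r2 & Hr2 & A2).
{ exact (L2 _ (locally_ball e2 (mkposreal _ He))). }
exists (Rmin r1 r2). split; [apply Rmin_pos; assumption |]. intros p Hp.
pose proof (Rmin_l r1 r2). pose proof (Rmin_r r1 r2).
specialize (A1 p ltac:(lra)). specialize (A2 p ltac:(lra)).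
apply Rabs_def2 in A1. apply Rabs_def2 in A2. lra.
Qed.

Lemma quotient_lt a b c d : 0 < b -> d < 0 -> a / b < c / d <-> c * b < a * d.
Proof.
intros Hb Hd. replace (a / b) with (a * d * / (b * d)) by (field; lra).
replace (c / d) with (c * b * / (b * d)) by (field; lra).
assert (/ (b * d) < 0) by (apply Rinv_lt_0_compat; nra). split; nra.
Qed.

(** An intermediate value argument in [p], between small values, where [h1 < h2], and a value in the
    common range where this fails. *)
Lemma matching_abscissae (Fp fp gp Fm fm gm h1 h2 : R -> R) (M m r : R) :
  (forall z, is_derive Fp z (fp z)) -> (forall z, is_derive Fm z (fm z)) ->
  (forall z, continuous fp z) -> (forall z, continuous gp z) ->
  (forall z, continuous fm z) -> (forall z, continuous gm z) ->
  Fp 0 = 0 -> Fm 0 = 0 ->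
  (forall z, 0 < z -> 0 < fp z) -> (forall z, z < 0 -> fm z < 0) -> m < 0 < M ->
  (forall z, 0 < z -> h1 (Fp z) = gp z / fp z) -> (forall z, z < 0 -> h2 (Fm z) = gm z / fm z) ->
  0 < r -> (forall p, 0 < p < r -> h1 p < h2 p) ->
  ~ (forall p, 0 < p -> p < Fp M -> p < Fm m -> h1 p < h2 p) ->
  exists zm zp, m < zm < 0 /\ 0 < zp < M /\ Fm zm = Fp zp /\ gm zm / fm zm = gp zp / fp zp.
Proof.
intros DFp DFm Cfp Cgp Cfm Cgm Fp0 Fm0 Pfp Nfm HmM Hh1 Hh2 Hr Hsmall Hnot.
assert (CFp : forall z, continuous Fp z) by (intros z; apply (is_derive_continuous Fp z (fp z)), DFp).
assert (CFm : forall z, continuous Fm z) by (intros z; apply (is_derive_continuous Fm z (fm z)), DFm).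
destruct (increasing_inverse Fp fp 0 M) as (a & A1 & A2 & A3 & A4 & _); [lra | exact CFp | |].
{ intros t Ht. split; [apply DFp | apply Pfp; lra]. }
(* Reflection makes [Fm] increasing. Within the range of the orbit, [a] is [x^+] and [- b] is [x^-],
   now with continuity at hand. *)
destruct (increasing_inverse (fun z => Fm (- z)) (fun z => - fm (- z)) 0 (- m)) as (b & B1 & B2 & B3 & B4 & _);
  [lra | apply continuous_reflect, CFm | |].
{ intros t Ht. split; [apply reflect_derive, DFm | specialize (Nfm (- t)); lra]. }
cbv beta in *. rewrite Ropp_0, Fm0, Ropp_involutive in B4. rewrite Fp0 in A4.
assert (Ha : forall p, 0 < p < Fp M -> 0 < a p < M /\ Fp (a p) = p).
{ intros p Hp. specialize (A1 p). specialize (A4 p ltac:(lra)). split; [| exact A4].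
  split; apply Rnot_le_lt; intros H.
  - replace (a p) with 0 in A4 by lra. lra.
  - replace (a p) with M in A4 by lra. lra. }
assert (Hb : forall p, 0 < p < Fm m -> m < - b p < 0 /\ Fm (- b p) = p).
{ intros p Hp. specialize (B1 p). specialize (B4 p ltac:(lra)). split; [| exact B4].
  split; apply Rnot_le_lt; intros H.
  - replace (- b p) with m in B4 by lra. lra.
  - replace (- b p) with 0 in B4 by lra. lra. }
(* The inequality [h1 < h2] cleared of denominators, whose product is negative. Unlike the
   quotients, [k] is continuous on the whole line, even where [fp] or [fm] vanishes. *)
set (k := fun p => gp (a p) * fm (- b p) - gm (- b p) * fp (a p)).
assert (Ck : forall p, continuous k p).
{ intros p.
  assert (Ca : forall g : R -> R, (forall z, continuous g z) -> continuous (fun p => g (a p)) p).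
  { intros g Cg. apply (continuous_comp a g); [apply A2 | apply Cg]. }
  assert (Cb : forall g : R -> R, (forall z, continuous g z) -> continuous (fun p => g (- b p)) p).
  { intros g Cg. apply (continuous_comp (fun p => - b p) g); [| apply Cg].
    apply (continuous_opp b p), B2. }
  apply (continuous_minus (fun p => gp (a p) * fm (- b p)) (fun p => gm (- b p) * fp (a p)));
    [apply (continuous_mult (fun p => gp (a p)) (fun p => fm (- b p)))
    |apply (continuous_mult (fun p => gm (- b p)) (fun p => fp (a p)))]; auto. }
assert (Hk : forall p, 0 < p -> p < Fp M -> p < Fm m -> h1 p < h2 p <-> 0 < k p).
{ intros p Hp0 Hp1 Hp2. destruct (Ha p ltac:(lra)) as [I1 E1]. destruct (Hb p ltac:(lra)) as [I2 E2].
  pose proof (quotient_lt (gp (a p)) (fp (a p)) (gm (- b p)) (fm (- b p))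
    ltac:(apply Pfp; lra) ltac:(apply Nfm; lra)) as Q.
  rewrite <- (Hh1 (a p)), <- (Hh2 (- b p)), E1, E2 in Q by lra. unfold k. rewrite Q. lra. }
apply not_all_ex_not in Hnot. destruct Hnot as (p2 & Hp2).
apply imply_to_and in Hp2. destruct Hp2 as [P0 Hp2].
apply imply_to_and in Hp2. destruct Hp2 as [P1 Hp2].
apply imply_to_and in Hp2. destruct Hp2 as [P2 Hn].
rewrite Hk in Hn by assumption.
set (p1 := Rmin (r / 2) p2). assert (Hp1 : 0 < p1) by (apply Rmin_pos; lra).
pose proof (Rmin_l (r / 2) p2). pose proof (Rmin_r (r / 2) p2). fold p1 in H, H0.
assert (K1 : 0 < k p1) by (apply Hk; try lra; apply Hsmall; lra).
destruct (intermediate_value k p1 p2 0) as (p & Hp & Kp).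
- lra.
- exact Ck.
- rewrite Rmin_right, Rmax_left; lra.
- destruct (Ha p ltac:(lra)) as [I1 E1]. destruct (Hb p ltac:(lra)) as [I2 E2].
  exists (- b p), (a p). split; [lra |]. split; [lra |]. split; [lra |].
  pose proof (Pfp (a p) ltac:(lra)). pose proof (Nfm (- b p) ltac:(lra)).
  unfold k in Kp. apply Rmult_eq_reg_r with (fm (- b p) * fp (a p)); [| nra].
  replace (gm (- b p) / fm (- b p) * (fm (- b p) * fp (a p))) with (gm (- b p) * fp (a p)) by (field; lra).
  replace (gp (a p) / fp (a p) * (fm (- b p) * fp (a p))) with (gp (a p) * fm (- b p)) by (field; lra). lra.
Qed.

Theorem theorem1p1
  (fp fm gp gm : R -> R)
  (smooth_fp : smooth fp) (smooth_fm : smooth fm)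
  (smooth_gp : smooth gp) (smooth_gm : smooth gm)
  (xe : R) (xe_ge0 : 0 <= xe)
  (H1 : forall x, 0 < x -> x <> xe -> 0 < gp x * (x - xe))
  (H2p : forall x, 0 < x -> 0 < fp x)
  (H2m : forall x, x < 0 -> fm x < 0)
  (xp xm : R -> R)
  (xpE : is_inverse_right (int_from_0 fp) xp)
  (xmE : is_inverse_left (int_from_0 fm) xm)
  (etap etam : R)
  (H3p : filterlim (fun p => gp (xp p) / fp (xp p)) (at_right 0) (locally etap))
  (H3m : filterlim (fun p => gm (xm p) / fm (xm p)) (at_right 0) (locally etam))
  (H3le : etap <= etam)
  (H3eq : etap = etam ->
          at_right 0 (fun p => gp (xp p) / fp (xp p) < gm (xm p) / fm (xm p)))
  (x y : R -> R) (T : R)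
  (Gamma : crossing_periodic_orbit (int_from_0 fp) gp (int_from_0 fm) gm x y T) :
  (surrounds_counterclockwise x y T (0, 0) /\
   surrounds_counterclockwise x y T (point_E (int_from_0 fp) xe)) /\
  (exists xsm xsp : R,
     xsm < 0 < xsp /\
     int_from_0 fm xsm = int_from_0 fp xsp /\
     gm xsm / fm xsm = gp xsp / fp xsp /\
     transversally_intersects_vertical x xsm /\
     transversally_intersects_vertical x xsp).
Proof.
pose proof (smooth_C1 _ smooth_fp) as C1_fp. pose proof (smooth_C1 _ smooth_fm) as C1_fm.
pose proof (smooth_C1 _ smooth_gp) as C1_gp. pose proof (smooth_C1 _ smooth_gm) as C1_gm.
assert (DFp := int_from_0_derive fp (fun t => C1_continuous fp t C1_fp)).
assert (DFm := int_from_0_derive fm (fun t => C1_continuous fm t C1_fm)).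
assert (C1_Fp : C1 (int_from_0 fp)) by (exists fp; split; [exact DFp | intros; apply C1_continuous, C1_fp]).
assert (C1_Fm : C1 (int_from_0 fm)) by (exists fm; split; [exact DFm | intros; apply C1_continuous, C1_fm]).
pose proof (int_from_0_0 fp) as Fp0. pose proof (int_from_0_0 fm) as Fm0.
destruct xpE as [_ Hxp]. destruct xmE as [_ Hxm].
destruct Gamma as (orbit & (ta & Hta) & (tb & Htb)).
set (Fp := int_from_0 fp) in *. set (Fm := int_from_0 fm) in *.
destruct (orbit_shape Fp gp Fm gm C1_Fp C1_Fm C1_gp C1_gm Fp0 Fm0 x y T orbit)
  as (t1 & t2 & H12 & V1 & V2 & Hneg & Hpos).
assert (Hrange : forall t, x t2 <= x t <= x t1) by exact (x_range Fp gp Fm gm C1_Fp C1_Fm Fp0 Fm0 x y T orbit t1 t2 Hneg Hpos).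
assert (Hm : x t2 < 0) by (pose proof (Hrange tb); lra).
assert (HM : 0 < x t1) by (pose proof (Hrange ta); lra).
assert (Htrans : forall c, x t2 < c < x t1 -> transversally_intersects_vertical x c)
  by exact (transversal_between Fp gp Fm gm C1_Fp C1_Fm Fp0 Fm0 x y T orbit t1 t2 H12 Hneg Hpos).
assert (Hsur : forall c, 0 <= c < x t1 -> surrounds_counterclockwise x y T (c, Fp c)).
{ intros c Hc. rewrite <- (glue_pos Fp Fm Fm0) by lra.
  apply (surrounds_between Fp gp Fm gm C1_Fp C1_Fm Fp0 Fm0 x y T orbit t1 t2 H12 Hneg Hpos). lra. }
split; [split |].
- replace (0, 0) with (0, Fp 0) by (rewrite Fp0; reflexivity). apply Hsur. lra.
- unfold point_E. destruct (Rlt_dec 0 xe) as [Hxe | Hxe].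
  + apply Hsur. split; [exact xe_ge0 |].
    assert (Hg : 0 < gp (x t1)) by (apply (gp_pos_at_max Fp gp Fm gm C1_Fp C1_Fm C1_gp Fp0 Fm0 x y T orbit t1 t2); assumption).
    (* If [x t1 <= xe], condition (1) makes [gp] negative just to the left of [x t1], while
       continuity makes it positive there. *)
    apply Rnot_le_lt. intros Hle.
    destruct (continuous_gt gp (x t1) 0 (C1_continuous gp _ C1_gp) Hg) as (r & Hr & Hgr).
    set (q := Rmax (x t1 / 2) (x t1 - r / 2)).
    assert (q < x t1) by (apply Rmax_lub_lt; lra).
    pose proof (Rmax_l (x t1 / 2) (x t1 - r / 2)). pose proof (Rmax_r (x t1 / 2) (x t1 - r / 2)).
    fold q in H0, H2. specialize (Hgr q ltac:(apply Rabs_def1; lra)).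
    specialize (H1 q ltac:(lra) ltac:(lra)). nra.
  + replace (0, 0) with (0, Fp 0) by (rewrite Fp0; reflexivity). apply Hsur. lra.
- destruct (crossing_times Fp gp Fm gm x y T orbit t1 t2 H12 0 (conj Hm HM))
    as (s0 & s1 & Hs0 & Hs1 & E0 & E1).
  set (hp := fun p => gp (xp p) / fp (xp p)) in *. set (hm := fun p => gm (xm p) / fm (xm p)) in *.
  assert (Hhp : forall z, 0 < z -> hp (Fp z) = gp z / fp z)
    by (intros z Hz; unfold hp; rewrite Hxp by lra; reflexivity).
  assert (Hhm : forall z, z < 0 -> hm (Fm z) = gm z / fm z)
    by (intros z Hz; unfold hm; rewrite Hxm by lra; reflexivity).
  destruct (ordered_near_0 hp hm etap etam H3p H3m H3le H3eq) as (r & Hr & Hsmall).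
  destruct (matching_abscissae Fp fp gp Fm fm gm hp hm (x t1) (x t2) r) as (zm & zp & Hzm & Hzp & EF & Eg);
    try assumption; try (intros; apply C1_continuous; assumption); try lra.
  (* If [hp < hm] held on the whole common range, the two half orbits, which have equal values at
     [p = 0], would be ordered. *)
  + intros Hord.
    assert (right : exists l u, half_orbit l u hp (Fp (x t1)) /\
              l 0 = speed Fp Fm x y s1 /\ u 0 = - speed Fp Fm x y s0)
      by (apply (right_half_orbit Fp gp Fm gm) with T t2 fp; assumption).
    assert (left : exists l u, half_orbit l u hm (Fm (x t2)) /\
              l 0 = speed Fp Fm x y s1 /\ u 0 = - speed Fp Fm x y s0)
      by (apply (left_half_orbit Fp gp Fm gm) with T t1 fm; assumption).
    destruct right as (l1 & u1 & O1 & L1 & U1). destruct left as (l2 & u2 & O2 & L2 & U2).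
    apply (half_orbits_not_ordered l1 u1 hp l2 u2 hm _ _ O1 O2); try congruence. exact Hord.
  + exists zm, zp. split; [lra |]. split; [exact EF |]. split; [exact Eg |].
    split; apply Htrans; lra.
Qed.
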